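(* 2-Colored Token Swapping is solvable in $O(n^3)$ time, where $n$ is the number of vertices. Moreover, a swapping sequence of minimum length between $f_0$ and $f_t$ can be constructed within the same running time.
   Context: Graphs are finite, simple and undirected; $n=|V|$. For $C=\{1,\dots,c\}$, a token-placement of $G=(V,E)$ is a surjective map $f\colon V\to C$. Two distinct token-placements $f,f'$ are adjacent if there is an edge $uv\in E$ with $f'(u)=f(v)$, $f'(v)=f(u)$ and $f'(w)=f(w)$ for all other $w$. A swapping sequence between $f$ and $f'$ is a sequence $f_1=f,\dots,f_h=f'$ of token-placements with consecutive members adjacent; its length is $h-1$. $\mathrm{OPT}(f,f')$ is the minimum length of such a sequence ($\infty$ if none). $c$-Colored Token Swapping is the decision problem: given $G$, token-placements $f_0,f_t\colon V\to\{1,\dots,c\}$ and an integer $\ell\ge0$, decide whether $\mathrm{OPT}(f_0,f_t)\le\ell$. *)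

(* Defs.v *)
From mathcomp Require Import all_boot.
Set Implicit Arguments. Unset Strict Implicit. Unset Printing Implicit Defensive.

Definition token_placement (n c : nat) (f : 'I_n -> nat) : Prop :=
  (forall v, 1 <= f v <= c) /\ (forall k, 1 <= k <= c -> exists v, f v = k).

Definition tp_adjacent (n : nat) (G : rel 'I_n) (f f' : 'I_n -> nat) : Prop :=
  (exists w, f' w <> f w) /\
  exists u v, G u v /\ f' u = f v /\ f' v = f u /\
              (forall w, w <> u -> w <> v -> f' w = f w).

Fixpoint swapping_seq (n c : nat) (G : rel 'I_n) (f : 'I_n -> nat)
    (s : seq ('I_n -> nat)) (ft : 'I_n -> nat) : Prop :=
  match s with
  | [::] => forall w, f w = ft w
  | g :: s' => token_placement c g /\ tp_adjacent G f g /\ swapping_seq c G g s' ft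
  end.

Definition OPT_le (n c : nat) (G : rel 'I_n) (f0 ft : 'I_n -> nat) (l : nat) : Prop :=
  exists s, swapping_seq c G f0 s ft /\ size s <= l.

Definition min_swapping_seq (n c : nat) (G : rel 'I_n) (f0 ft : 'I_n -> nat)
    (s : seq ('I_n -> nat)) : Prop :=
  swapping_seq c G f0 s ft /\
  forall s', swapping_seq c G f0 s' ft -> size s <= size s'.

Definition swap_at (n : nat) (f : 'I_n -> nat) (u v : 'I_n) : 'I_n -> nat :=
  fun w => if w == u then f v else if w == v then f u else f w.

(* Machine model: a unit-cost RAM with addition, truncated subtraction,*)
(* indirect addressing and conditional jumps.  Memory is nat -> nat.    *)

Inductive instr :=
| IConst of nat & nat
| IAdd of nat & nat & nat
| ISub of nat & nat & nat
| ILoad of nat & nat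
| IStore of nat & nat
| IJz of nat & nat
| IJmp of nat
| IHalt.

Definition program := seq instr.
Definition memory := nat -> nat.

Definition upd (m : memory) (a v : nat) : memory :=
  fun x => if x == a then v else m x.

(* one step; None = halted (IHalt, or pc outside the program) *)
Definition ram_step (P : program) (st : nat * memory) : option (nat * memory) :=
  let: (pc, m) := st in
  match nth IHalt P pc with
  | IConst r k => Some (pc.+1, upd m r k)
  | IAdd r a b => Some (pc.+1, upd m r (m a + m b))
  | ISub r a b => Some (pc.+1, upd m r (m a - m b))
  | ILoad r a => Some (pc.+1, upd m r (m (m a)))
  | IStore a b => Some (pc.+1, upd m (m a) (m b))
  | IJz a l => Some (if m a == 0 then l else pc.+1, m)
  | IJmp l => Some (l, m)
  | IHalt => None
  end.

Fixpoint ram_exec (P : program) (T : nat) (st : nat * memory) : option memory :=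
  match ram_step P st with
  | None => Some st.2
  | Some st' => if T is T'.+1 then ram_exec P T' st' else None
  end.

(* Input encoding of an instance (G, f0, ft, l) with n vertices:        *)
(*   M[0] = n, M[1] = l,                                                *)
(*   M[2 + i*n + j] = [G i j]  (adjacency matrix),                      *)
(*   M[2 + n*n + i] = f0 i,  M[2 + n*n + n + i] = ft i,                 *)
(*   all other cells 0; execution starts at pc = 0.                     *)

Definition nat_fun (n : nat) (f : 'I_n -> nat) (i : nat) : nat :=
  if insub i is Some j then f j else 0.

Definition nat_rel (n : nat) (G : rel 'I_n) (i j : nat) : bool :=
  match insub i, insub j with
  | Some a, Some b => G a b
  | _, _ => false
  end.

Definition input_mem (n : nat) (G : rel 'I_n) (f0 ft : 'I_n -> nat) (l : nat) : memory :=
  fun x =>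
    if x == 0 then n
    else if x == 1 then l
    else if x < 2 + n * n then nat_rel G ((x - 2) %/ n) ((x - 2) %% n) : nat
    else if x < 2 + n * n + n then nat_fun f0 (x - 2 - n * n)
    else if x < 2 + n * n + n + n then nat_fun ft (x - 2 - n * n - n)
    else 0.

(* Output convention for the construction of a sequence:
   M[0] = 0 if no swapping sequence exists; otherwise M[0] = 1,
   M[1] = k is the length, and the j-th swap (j < k) is along the edge
   (M[2+2j], M[3+2j]). *)
Definition encodes_seq (n : nat) (f0 : 'I_n -> nat) (s : seq ('I_n -> nat))
    (m : memory) : Prop :=
  m 0 = 1 /\ m 1 = size s /\
  forall j, j < size s ->
    exists u v : 'I_n, val u = m (2 + 2 * j) /\ val v = m (3 + 2 * j) /\
      forall w, nth f0 s j w = swap_at (nth f0 (f0 :: s) j) u v w.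

(* Main.v *)
Require Import Defs.
From mathcomp Require Import all_boot zify.
Set Implicit Arguments. Unset Strict Implicit. Unset Printing Implicit Defensive.

(** A placement is a 0/1 configuration (1 for a token of color 1), and a swap
   moves one unit of it along an edge, so a swapping sequence is an integral flow
   with unit edge costs.  A primal-dual method maintains a flow x and potentials
   pi with |pi u - pi v| <= 1 on edges and x u v > 0 only if pi v = pi u + 1.  Each
   round searches the admissible residual arcs from the vertices with excess; it
   either augments along a path to a deficit or raises pi by one on the unreached
   vertices.  At most n rounds augment, so after 2n rounds of cost O(n^2) either
   the flow meets the target, or all deficits have potential at least n while the
   excesses have potential 0; then some potential value is missed by every vertex,
   and this empty level separates the graph.  In the first case the flow is
   decomposed into paths on which pi increases, and on each path the tokens are
   shifted from the front: every swap raises the sum of pi over the tokens by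
   exactly one, and since pi is 1-Lipschitz no swap can raise it by more.

   The algorithm is written in a loop language whose only loop runs over
   0, ..., n - 1, so that the running time is bounded by the loop nesting. *)

(** Impossibility and optimality both follow from one inequality: if vertex weights differ by at
    most c across edges, a swap changes the total weight of the tokens of color 1 by at most c. With
    c = 1 and the final potentials this bounds the length from below; with c = 0 and the indicator
    of one side of the empty level it excludes every sequence. Loops cannot stop early, so each runs
    for the longest time that may be required and surplus iterations must do nothing harmful. The
    decomposition stays cubic because there are at most n walks, each has at most 2n steps as pi
    rises along it, and a step costs O(n). The other obstacle is the machine: the input fills the
    low addresses, where registers have to live, and the output must end up there again, so
    hand-written code surrounds the compiled program. *)

Arguments upd : simpl never.

(** * Runs of the RAM *)

Lemma upd_eq (m : memory) a v : upd m a v a = v.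
Proof. by rewrite /upd eqxx. Qed.

Lemma upd_neq (m : memory) a v x : x != a -> upd m a v x = m x.
Proof. by rewrite /upd => /negbTE ->. Qed.

(** Unlike [ram_exec], a run may stop in a state that is not halted, so runs of consecutive code
    fragments compose; [reaches_halt] converts the whole run at the end. *)
Fixpoint ram_run (P : program) (t : nat) (st : nat * memory) :=
  if t is t'.+1 then
    if ram_step P st is Some st' then ram_run P t' st' else None
  else Some st.

Definition reaches P T st st' := exists2 t, t <= T & ram_run P t st = Some st'.

Lemma ram_run_add P t1 t2 st st' :
  ram_run P t1 st = Some st' -> ram_run P (t1 + t2) st = ram_run P t2 st'.
Proof.
elim: t1 st => [st [->]//|t IH st] /=.
by case: (ram_step P st) => // st1; exact: IH.
Qed.

Lemma reaches_refl P T st : reaches P T st st.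
Proof. by exists 0. Qed.

Lemma reaches_trans P T1 T2 st1 st2 st3 :
  reaches P T1 st1 st2 -> reaches P T2 st2 st3 -> reaches P (T1 + T2) st1 st3.
Proof.
move=> [t1 h1 e1] [t2 h2 e2]; exists (t1 + t2); first exact: leq_add.
by rewrite (ram_run_add _ e1).
Qed.

Lemma reaches_weaken P T1 T2 st st' :
  T1 <= T2 -> reaches P T1 st st' -> reaches P T2 st st'.
Proof. by move=> le12 [t h e]; exists t; first exact: leq_trans le12. Qed.

Lemma reaches_step P T st st1 st2 :
  ram_step P st = Some st1 -> reaches P T st1 st2 -> reaches P T.+1 st st2.
Proof. by move=> e [t h e']; exists t.+1; rewrite //= e. Qed.

Lemma reaches_halt P T st pc m :
  reaches P T st (pc, m) -> nth IHalt P pc = IHalt -> ram_exec P T st = Some m.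
Proof.
move=> [t letT run_t] halt; move: letT run_t.
elim: t T st => [|t IH] [|T] st //=.
- by move=> _ [->]; rewrite /= halt.
- by move=> _ [->]; rewrite /= halt.
by case: (ram_step P st) => // st1; exact: IH.
Qed.

Definition code_at (P : program) pc (c : program) :=
  forall i, i < size c -> nth IHalt P (pc + i) = nth IHalt c i.

Lemma code_at_cat P pc c1 c2 : code_at P pc (c1 ++ c2) ->
  code_at P pc c1 /\ code_at P (pc + size c1) c2.
Proof.
move=> H; split=> i lt_i.
  by rewrite H ?nth_cat ?lt_i // size_cat ltn_addr.
by rewrite -addnA H ?size_cat ?ltn_add2l // nth_cat ltnNge leq_addr addKn.
Qed.

Lemma code_at_cons P pc i c : code_at P pc (i :: c) ->
  nth IHalt P pc = i /\ code_at P pc.+1 c.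
Proof.
move=> H; split; first by have /= := H 0 isT; rewrite addn0.
by move=> j lt_j; have /= := H j.+1 lt_j; rewrite addnS.
Qed.

Lemma code_at_mid c1 c2 c3 : code_at (c1 ++ c2 ++ c3) (size c1) c2.
Proof.
by move=> i lt_i; rewrite nth_cat ltnNge leq_addr addKn nth_cat lt_i.
Qed.

Lemma code_at_end c1 c2 : code_at (c1 ++ c2) (size c1) c2.
Proof. by rewrite -[c1 ++ c2]cats0 -catA; exact: code_at_mid. Qed.

(** Jump-free code is run by folding [effect] over it, so its result is obtained by computation
    without following the program counter. *)
Definition straight i :=
  match i with IJz _ _ | IJmp _ | IHalt => false | _ => true end.

Definition effect (m : memory) i : memory :=
  match i with
  | IConst r k => upd m r k
  | IAdd r a b => upd m r (m a + m b)
  | ISub r a b => upd m r (m a - m b)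
  | ILoad r a => upd m r (m (m a))
  | IStore a b => upd m (m a) (m b)
  | _ => m
  end.

Lemma reaches_straight P pc c m : all straight c -> code_at P pc c ->
  reaches P (size c) (pc, m) (pc + size c, foldl effect m c).
Proof.
elim: c pc m => [|i c IH] pc m /=; first by rewrite addn0 => *; apply: reaches_refl.
move=> /andP[str_i str_c] /code_at_cons[at_i at_c].
apply: (@reaches_step _ _ _ (pc.+1, effect m i)); last first.
  by rewrite addnS -addSn; exact: IH.
by rewrite /ram_step at_i; case: i str_i {at_i}.
Qed.

(** * A loop language with syntactic running time *)

Inductive expr :=
| Cst of nat
| Size
| Var of nat
| Plus of expr & expr
| Minus of expr & expr
| Get of nat & expr.

Inductive cmd :=
| Skip
| Asg of nat & expr
| Put of nat & expr & expr
| Seq of cmd & cmd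
| If of expr & cmd & cmd
| For of nat & cmd.

Record state := State { reg : nat -> nat; arr : nat -> nat -> nat }.

Definition set_reg s x v :=
  State (fun y => if y == x then v else reg s y) (arr s).

Definition set_arr s a i v :=
  State (reg s) (fun b => if b == a then upd (arr s a) i v else arr s b).

Fixpoint eval n e s : nat :=
  match e with
  | Cst k => k
  | Size => n
  | Var x => reg s x
  | Plus e1 e2 => eval n e1 s + eval n e2 s
  | Minus e1 e2 => eval n e1 s - eval n e2 s
  | Get a e => arr s a (eval n e s)
  end.

Fixpoint ev n c s : state :=
  match c with
  | Skip => s
  | Asg x e => set_reg s x (eval n e s)
  | Put a e1 e2 => set_arr s a (eval n e1 s) (eval n e2 s)
  | Seq c1 c2 => ev n c2 (ev n c1 s)
  | If e c1 c2 => if eval n e s == 0 then ev n c2 s else ev n c1 s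
  | For x c =>
    set_reg (foldl (fun s i => ev n c (set_reg s x i)) s (iota 0 n)) x n
  end.

(** A syntactic bound on what a command writes. That a register or array survives a piece of code
    becomes a decidable non-membership, discharged by [isT] in later proofs. *)
Fixpoint mod_regs c :=
  match c with
  | Skip | Put _ _ _ => [::]
  | Asg x _ => [:: x]
  | Seq c1 c2 | If _ c1 c2 => mod_regs c1 ++ mod_regs c2
  | For x c => x :: mod_regs c
  end.

Fixpoint mod_arrs c :=
  match c with
  | Skip | Asg _ _ => [::]
  | Put a _ _ => [:: a]
  | Seq c1 c2 | If _ c1 c2 => mod_arrs c1 ++ mod_arrs c2
  | For x c => mod_arrs c
  end.

Definition frame c s s' :=
  (forall r, r \notin mod_regs c -> reg s' r = reg s r) /\
  (forall a, a \notin mod_arrs c -> arr s' a = arr s a).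

Lemma frame_refl c s : frame c s s. Proof. by []. Qed.

Lemma frame_trans c s1 s2 s3 : frame c s1 s2 -> frame c s2 s3 -> frame c s1 s3.
Proof.
by move=> [r1 a1] [r2 a2]; split=> z hz; [rewrite r2 // r1|rewrite a2 // a1].
Qed.

Lemma frame_set_reg x c s v : frame (For x c) s (set_reg s x v).
Proof. by split=> //= r; rewrite inE negb_or => /andP[/negbTE->]. Qed.

Lemma frame_ev n c s : frame c s (ev n c s).
Proof.
elim: c s => //= [x e|a e1 e2|c1 IH1 c2 IH2|e c1 IH1 c2 IH2|x c IH] s.
- by split=> //= r; rewrite inE => /negbTE->.
- by split=> //= b; rewrite inE => /negbTE->.
- have [[r1 a1] [r2 a2]] := (IH1 s, IH2 (ev n c1 s)).
  by split=> z; rewrite mem_cat negb_or => /andP[z1 z2];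
    [rewrite r2 // r1|rewrite a2 // a1].
- have [[r1 a1] [r2 a2]] := (IH1 s, IH2 s).
  by split=> z; rewrite mem_cat negb_or => /andP[z1 z2]; case: eqP => _; auto.
apply: frame_trans (frame_set_reg _ _ _ _).
elim: (iota 0 n) s => [|i l IHl] s /=; first exact: frame_refl.
apply: frame_trans (IHl _); apply: frame_trans (frame_set_reg _ c _ i) _.
have [r1 a1] := IH (set_reg s x i); split=> //= r.
by rewrite inE negb_or => /andP[_ hr]; rewrite r1.
Qed.

(** * Compilation to the RAM *)

(* Cell 0 holds n, cells 1..39 the registers, cells 40..63 temporaries, and
   cell [64 + 16 * i + a] holds entry i of array a. *)

Definition tmp d := 40 + d.
Definition cell a i := 64 + 16 * i + a.

(** The stride 16 is a power of two, so four doublings replace the multiplication. *)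
Definition compile_addr a d : program :=
  [:: IAdd (tmp d) (tmp d) (tmp d); IAdd (tmp d) (tmp d) (tmp d);
      IAdd (tmp d) (tmp d) (tmp d); IAdd (tmp d) (tmp d) (tmp d);
      IConst (tmp d.+1) (64 + a); IAdd (tmp d) (tmp d) (tmp d.+1)].

Arguments compile_addr : simpl never.

Fixpoint compile_expr e d : program :=
  match e with
  | Cst k => [:: IConst (tmp d) k]
  | Size => [:: IConst (tmp d) 0; IAdd (tmp d) (tmp d) 0]
  | Var x => [:: IConst (tmp d) 0; IAdd (tmp d) (tmp d) x]
  | Plus e1 e2 =>
    compile_expr e1 d ++ compile_expr e2 d.+1 ++ [:: IAdd (tmp d) (tmp d) (tmp d.+1)]
  | Minus e1 e2 =>
    compile_expr e1 d ++ compile_expr e2 d.+1 ++ [:: ISub (tmp d) (tmp d) (tmp d.+1)]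
  | Get a e => compile_expr e d ++ compile_addr a d ++ [:: ILoad (tmp d) (tmp d)]
  end.

(** A bound on the number of temporaries. An array access counts one more than its index because
    [compile_addr] keeps a constant in the next temporary. *)
Fixpoint depth e :=
  match e with
  | Cst _ | Size | Var _ => 1
  | Plus e1 e2 | Minus e1 e2 => (maxn (depth e1) (depth e2)).+1
  | Get _ e => (depth e).+1
  end.

Fixpoint wf_expr e :=
  match e with
  | Cst _ | Size => true
  | Var x => 0 < x < 40
  | Plus e1 e2 | Minus e1 e2 => wf_expr e1 && wf_expr e2
  | Get a e => (a < 16) && wf_expr e
  end.

Definition simulates n (m : memory) s :=
  [/\ m 0 = n, forall r, 0 < r < 40 -> m r = reg s r
    & forall a i, a < 16 -> m (cell a i) = arr s a i].

Lemma simulates_tmp n m m' s : simulates n m s ->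
  (forall x, (x < 40) || (64 <= x) -> m' x = m x) -> simulates n m' s.
Proof.
move=> [h0 hr ha] e; split=> [|r hr1|a i ha1].
- by rewrite e.
- by rewrite e; [exact: hr|lia].
by rewrite e; [exact: ha|rewrite /cell; lia].
Qed.

Lemma compile_addr_ok a d m : let m' := foldl effect m (compile_addr a d) in
  m' (tmp d) = cell a (m (tmp d)) /\
  forall x, x != tmp d -> x != tmp d.+1 -> m' x = m x.
Proof.
rewrite /compile_addr /= /upd; split=> [|x /negbTE-> /negbTE->] //.
have -> : tmp d == tmp d.+1 = false by rewrite /tmp; lia.
by rewrite !eqxx /cell; lia.
Qed.

Lemma compile_expr_straight e d : all straight (compile_expr e d).
Proof.
by elim: e d => //= [e1 IH1 e2 IH2|e1 IH1 e2 IH2|a e IH] d;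
  rewrite ?all_cat ?IH1 ?IH2 ?IH.
Qed.

(** Code at level d leaves the temporaries below d alone, so a left operand survives the evaluation
    of the right one at level d + 1. The bound 24 is the number of temporary cells. *)
Lemma compile_expr_ok n e d m s : simulates n m s -> wf_expr e -> d + depth e < 24 ->
  let m' := foldl effect m (compile_expr e d) in
  m' (tmp d) = eval n e s /\
  forall x, (x < tmp d) || (64 <= x) -> m' x = m x.
Proof.
(* Sums and differences are treated together, for an operation [op] and its instruction [opi]. *)
have lemma2 op opi e1 e2 :
  (forall d m s, simulates n m s -> wf_expr e1 -> d + depth e1 < 24 ->
    let m' := foldl effect m (compile_expr e1 d) in
    m' (tmp d) = eval n e1 s /\
    forall x, (x < tmp d) || (64 <= x) -> m' x = m x) ->
  (forall d m s, simulates n m s -> wf_expr e2 -> d + depth e2 < 24 ->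
    let m' := foldl effect m (compile_expr e2 d) in
    m' (tmp d) = eval n e2 s /\
    forall x, (x < tmp d) || (64 <= x) -> m' x = m x) ->
  (forall r a b m, effect m (opi r a b) = upd m r (op (m a) (m b))) ->
  forall d m s, simulates n m s -> wf_expr e1 && wf_expr e2 ->
  d + (maxn (depth e1) (depth e2)).+1 < 24 ->
  let m' := foldl effect m (compile_expr e1 d ++ compile_expr e2 d.+1 ++
              [:: opi (tmp d) (tmp d) (tmp d.+1)]) in
  m' (tmp d) = op (eval n e1 s) (eval n e2 s) /\
  forall x, (x < tmp d) || (64 <= x) -> m' x = m x.
- move=> IH1 IH2 Eop {}d {}m {}s sim_m /andP[w1 w2] hd.
  have [v1 k1] := IH1 d m s sim_m w1 ltac:(lia).
  rewrite /= !foldl_cat /=; set m1 := foldl effect m _ in v1 k1 *.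
  have sim1 : simulates n m1 s.
    by apply: simulates_tmp sim_m _ => x hx; apply: k1; rewrite /tmp; lia.
  have [v2 k2] := IH2 d.+1 m1 s sim1 w2 ltac:(lia).
  set m2 := foldl effect m1 _ in v2 k2 *; rewrite Eop.
  split=> [|x hx]; first by rewrite upd_eq v2 k2 ?v1 // /tmp; lia.
  rewrite upd_neq; last by rewrite /tmp in hx *; lia.
  by rewrite k2 ?k1 //; rewrite /tmp in hx *; lia.
elim: e d m s => [k|||e1 IH1 e2 IH2|e1 IH1 e2 IH2|a e IH]; last first.
- move=> d m s sim_m /andP[ha we] hd.
  have {}hd : d + depth e < 23 by move: hd => /=; lia.
  have [v k] := IH d m s sim_m we ltac:(lia).
  rewrite -[compile_expr (Get a e) d]/(compile_expr e d ++ compile_addr a d ++ _).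
  rewrite !foldl_cat; set m1 := foldl effect m _ in v k *.
  have [va ka] := compile_addr_ok a d m1.
  set m2 := foldl effect m1 (compile_addr a d) in va ka *; rewrite [foldl effect m2 _]/=.
  have sim2 : simulates n m2 s.
    apply: simulates_tmp sim_m _ => x hx.
    by rewrite ka ?k //; rewrite /tmp in hx *; lia.
  split=> [|x hx]; first by rewrite upd_eq;  rewrite va v; case: sim2 => _ _ ->.
  by rewrite upd_neq ?ka ?k //; rewrite /tmp in hx *; lia.
- by move=> d m s; apply: lemma2.
- by move=> d m s; apply: lemma2.
- move=> x d m s [h0 hr ha]; rewrite /= => wx hd; split=> [|y hy].
    by rewrite !upd_eq upd_neq ?hr // /tmp; lia.
  by rewrite !upd_neq //; rewrite /tmp in hy *; lia.
- move=> d m s [h0 hr ha] _; rewrite /= => hd; split=> [|y hy].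
    by rewrite !upd_eq upd_neq ?h0 // /tmp; lia.
  by rewrite !upd_neq //; rewrite /tmp in hy *; lia.
move=> d m s sim_m _; rewrite /= => hd; split=> [|y hy]; first by rewrite upd_eq.
by rewrite !upd_neq //; rewrite /tmp in hy *; lia.
Qed.

Fixpoint clen c :=
  match c with
  | Skip => 0
  | Asg _ e => size (compile_expr e 0) + 2
  | Put a e1 e2 => size (compile_expr e1 0) + 6 + size (compile_expr e2 1) + 1
  | Seq c1 c2 => clen c1 + clen c2
  | If e c1 c2 => size (compile_expr e 0) + clen c1 + clen c2 + 2
  | For _ c => clen c + 6
  end.

Fixpoint compile c pc : program :=
  match c with
  | Skip => [::]
  | Asg x e => compile_expr e 0 ++ [:: IConst x 0; IAdd x x (tmp 0)]
  | Put a e1 e2 => compile_expr e1 0 ++ compile_addr a 0 ++ compile_expr e2 1 ++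
                  [:: IStore (tmp 0) (tmp 1)]
  | Seq c1 c2 => compile c1 pc ++ compile c2 (pc + clen c1)
  | If e c1 c2 =>
    let p := pc + size (compile_expr e 0) in
    compile_expr e 0 ++ IJz (tmp 0) (p.+1 + clen c1).+1 ::
    compile c1 p.+1 ++ IJmp ((p.+1 + clen c1).+1 + clen c2) ::
    compile c2 (p.+1 + clen c1).+1
  | For x c =>
    [:: IConst x 0, ISub (tmp 0) 0 x, IJz (tmp 0) (pc + (clen c + 6)) &
     compile c pc.+3 ++ [:: IConst (tmp 0) 1; IAdd x x (tmp 0); IJmp pc.+1]]
  end.

(** An [If] is charged for both branches, so the bound depends on n and the text of the command
    only. *)
Fixpoint cost n c :=
  match c with
  | Skip => 0
  | Asg _ _ | Put _ _ _ => clen c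
  | Seq c1 c2 => cost n c1 + cost n c2
  | If e c1 c2 => size (compile_expr e 0) + 1 + (cost n c1 + cost n c2 + 1)
  | For _ c => n * (cost n c + 5) + 3
  end.

(** Compiled loops count in the register x itself, whereas [ev] sets x from the list of indices; the
    condition on [For] makes the two agree. *)
Fixpoint wf_cmd c :=
  match c with
  | Skip => true
  | Asg x e => [&& 0 < x < 40, wf_expr e & depth e < 22]
  | Put a e1 e2 => [&& a < 16, wf_expr e1, depth e1 < 22, wf_expr e2 & depth e2 < 22]
  | Seq c1 c2 => wf_cmd c1 && wf_cmd c2
  | If e c1 c2 => [&& wf_expr e, depth e < 22, wf_cmd c1 & wf_cmd c2]
  | For x c => [&& 0 < x < 40, x \notin mod_regs c & wf_cmd c]
  end.

Lemma size_compile c pc : size (compile c pc) = clen c.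
Proof.
elim: c pc => //= [x e|a e1 e2|c1 IH1 c2 IH2|e c1 IH1 c2 IH2|x c IH] pc;
  rewrite ?size_cat /= ?size_cat /= ?IH ?IH1 ?IH2 //=; lia.
Qed.

Lemma simulates_set_reg n m s x v : 0 < x < 40 -> simulates n m s ->
  simulates n (upd m x v) (set_reg s x v).
Proof.
move=> hx [h0 hr ha]; split=> [|r hr1|a i ha1] /=.
- by rewrite upd_neq //; lia.
- by rewrite /upd; case: eqP => // _; exact: hr.
by rewrite upd_neq ?ha // /cell; lia.
Qed.

Lemma compile_ok n P c pc m s : wf_cmd c -> simulates n m s ->
  code_at P pc (compile c pc) ->
  exists2 m', reaches P (cost n c) (pc, m) (pc + clen c, m') &
    simulates n m' (ev n c s).
Proof.
elim: c pc m s => [|x e|a e1 e2|c1 IH1 c2 IH2|e c1 IH1 c2 IH2|x c IH] pc m s.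
- by move=> _ sim_m _; exists m => //; rewrite addn0; exact: reaches_refl.
- move=> /and3P[hx we de] sim_m at_c; exists (foldl effect m (compile (Asg x e) pc)).
    rewrite -(size_compile (Asg x e) pc) /cost -(size_compile (Asg x e) pc).
    by apply: reaches_straight => //=; rewrite all_cat compile_expr_straight.
  rewrite [compile _ _]/= foldl_cat.
  have [v k] := compile_expr_ok (d := 0) sim_m we ltac:(lia).
  set m1 := foldl effect m _ in v k *.
  have sim1 : simulates n m1 s.
    by apply: simulates_tmp sim_m _ => y hy; apply: k; rewrite /tmp; lia.
  have [h0 hr ha] := simulates_set_reg (eval n e s) hx sim1.
  have E y : foldl effect m1 [:: IConst x 0; IAdd x x (tmp 0)] y =
             upd m1 x (eval n e s) y.
    have t0 : tmp 0 == x = false by rewrite /tmp; lia.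
    by rewrite /= /upd eqxx t0 v; case: eqP.
  by split=> [|r hr1|b i hb]; rewrite E; auto.
- move=> /and5P[ha w1 d1 w2 d2] sim_m at_c.
  exists (foldl effect m (compile (Put a e1 e2) pc)).
    rewrite -(size_compile (Put a e1 e2) pc) /cost -(size_compile (Put a e1 e2) pc).
    apply: reaches_straight => //=; rewrite all_cat compile_expr_straight /=.
    by rewrite all_cat compile_expr_straight.
  rewrite -[compile _ _]/(compile_expr e1 0 ++ compile_addr a 0 ++
    compile_expr e2 1 ++ _) !foldl_cat.
  have [v1 k1] := compile_expr_ok (d := 0) sim_m w1 ltac:(lia).
  set m1 := foldl effect m _ in v1 k1 *.
  have [va ka] := compile_addr_ok a 0 m1.
  set m2 := foldl effect m1 (compile_addr a 0) in va ka *.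
  have sim2 : simulates n m2 s.
    apply: simulates_tmp sim_m _ => y hy.
    by rewrite ka ?k1 // /tmp; lia.
  have [v2 k2] := compile_expr_ok (d := 1) sim2 w2 ltac:(lia).
  set m3 := foldl effect m2 _ in v2 k2 *.
  have [h0 hr har] : simulates n m3 s.
    by apply: simulates_tmp sim2 _ => y hy; apply: k2; rewrite /tmp; lia.
  rewrite /= v2 k2 // va v1.
  split=> [|r hr1|b i hb] /=.
  + by rewrite upd_neq.
  + by rewrite upd_neq ?hr // /cell; lia.
  rewrite /upd; case: (b =P a) => [->|ne_ba]; last first.
    by case: (cell b i =P _) => [|_]; [rewrite /cell; lia|exact: har].
  have -> : (cell a i == cell a (eval n e1 s)) = (i == eval n e1 s).
    by rewrite /cell; lia.
  by rewrite har.
- move=> /andP[w1 w2] sim_m /code_at_cat[at1]; rewrite size_compile => at2.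
  have [m1 r1 sim1] := IH1 pc m s w1 sim_m at1.
  have [m2 r2 sim2] := IH2 _ m1 _ w2 sim1 at2.
  by exists m2 => //=; apply: reaches_trans r1 _; rewrite addnA.
- move=> /and4P[we de w1 w2] sim_m; rewrite [compile _ _]/=; set p := pc + _.
  move=> /code_at_cat[at_e]; rewrite -/p => /code_at_cons[at_z].
  move=> /code_at_cat[at1]; rewrite size_compile => /code_at_cons[at_j at2].
  have r_e := reaches_straight m (compile_expr_straight e 0) at_e.
  have [v k] := compile_expr_ok (d := 0) sim_m we ltac:(lia).
  set m1 := foldl effect m _ in v k r_e *.
  have sim1 : simulates n m1 s.
    by apply: simulates_tmp sim_m _ => y hy; apply: k; rewrite /tmp; lia.
  have end_eq : pc + clen (If e c1 c2) = (p.+1 + clen c1).+1 + clen c2.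
    by rewrite /p /=; lia.
  rewrite end_eq /= -addnA; case: eqP => [e0|ne0].
    have [m2 r2 sim2] := IH2 _ m1 s w2 sim1 at2; exists m2 => //.
    apply: reaches_trans r_e _; apply: reaches_step; first by rewrite /= -/p at_z.
    by rewrite v e0 /=; apply: reaches_weaken r2; lia.
  have [m2 r2 sim2] := IH1 _ m1 s w1 sim1 at1; exists m2 => //.
  apply: reaches_trans r_e _; apply: reaches_step; first by rewrite /= -/p at_z.
  have -> : cost n c1 + cost n c2 + 1 = cost n c1 + (cost n c2).+1 by lia.
  rewrite v; case: eqP => // _; apply: reaches_trans r2 _.
  by apply: reaches_step; [rewrite /= at_j|exact: reaches_refl].
move=> /and3P[hx nmod wc] sim_m; rewrite [compile _ _]/=.
move=> /code_at_cons[at_0] /code_at_cons[at_1] /code_at_cons[at_2].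
move=> /code_at_cat[at_c]; rewrite size_compile => /code_at_cons[at_3].
move=> /code_at_cons[at_4] /code_at_cons[at_5 _].
(* Induction on the number k of remaining iterations, from the loop test on. The counter cell holds
   i, whatever x is in [s], hence [set_reg s x i]. *)
have loop : forall k i m s, i + k = n -> simulates n m (set_reg s x i) ->
    exists2 m', reaches P (k * (cost n c + 5 ) + 2) (pc.+1, m)
                        (pc + (clen c + 6), m') &
     simulates n m' (set_reg
       (foldl (fun s i => ev n c (set_reg s x i)) s (iota i k)) x n).
  clear m s sim_m; elim=> [|k IHk] i m s eq_n sim_i.
    exists (upd m (tmp 0) (m 0 - m x)).
      apply: reaches_step; first by rewrite /= at_1.
      apply: reaches_step; first by rewrite /= at_2.
      rewrite upd_eq; have [-> -> //= _] := sim_i.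
      by rewrite eqxx -eq_n addn0 subnn /=; exact: reaches_refl.
    rewrite /= -{2}eq_n addn0; apply: simulates_tmp sim_i _ => y hy.
    by rewrite upd_neq // /tmp; lia.
  set m1 := upd m (tmp 0) (m 0 - m x).
  have sim1 : simulates n m1 (set_reg s x i).
    by apply: simulates_tmp sim_i _ => y hy; rewrite /m1 upd_neq // /tmp; lia.
  have [m2 r2 sim2] := IH _ m1 _ wc sim1 at_c.
  set m3 := upd m2 (tmp 0) 1; set m4 := upd m3 x (m3 x + m3 (tmp 0)).
  have sim3 : simulates n m3 (ev n c (set_reg s x i)).
    by apply: simulates_tmp sim2 _ => y hy; rewrite /m3 upd_neq // /tmp; lia.
  have m3x : m3 x + m3 (tmp 0) = i.+1.
    have [_ -> // _] := sim3; rewrite (frame_ev n c _).1 //= eqxx.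
    by rewrite /m3 upd_eq addn1.
  have sim4 : simulates n m4 (set_reg (ev n c (set_reg s x i)) x i.+1).
    by rewrite /m4 m3x; exact: simulates_set_reg.
  have [m5 r5 sim5] := IHk i.+1 m4 _ ltac:(lia) sim4.
  exists m5 => //.
  have -> : k.+1 * (cost n c + 5) + 2 =
     (cost n c + (k * (cost n c + 5) + 2).+3).+2 by lia.
  apply: reaches_step; first by rewrite /= at_1.
  apply: reaches_step; first by rewrite /= at_2.
  rewrite -/m1 {1}/m1 upd_eq; have [-> -> //= _] := sim_i.
  have -> : n - (if x == x then i else reg s x) == 0 = false by rewrite eqxx; lia.
  apply: reaches_trans r2 _.
  apply: reaches_step; first by rewrite /= at_3.
  apply: reaches_step; first by rewrite /= at_4.
  by apply: reaches_step; first by rewrite /= at_5.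
have [m' r' sim'] := loop n 0 (upd m x 0) s (add0n n) (simulates_set_reg 0 hx sim_m).
exists m' => //=; rewrite addnS; apply: reaches_step; last exact: r'.
by rewrite /= at_0.
Qed.

Fixpoint nesting c :=
  match c with
  | Skip | Asg _ _ | Put _ _ _ => 0
  | Seq c1 c2 | If _ c1 c2 => maxn (nesting c1) (nesting c2)
  | For _ c => (nesting c).+1
  end.

(** Powers of n + 1 instead of n absorb the constant terms even when n = 0. *)
Lemma cost_polynomial c : exists C, forall n, cost n c <= C * n.+1 ^ nesting c.
Proof.
elim: c => [|x e|a e1 e2|c1 [C1 H1] c2 [C2 H2]|e c1 [C1 H1] c2 [C2 H2]|x c [C H]].
- by exists 0.
- by exists (clen (Asg x e)) => n; rewrite muln1.
- by exists (clen (Put a e1 e2)) => n; rewrite muln1.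
- exists (C1 + C2) => n /=; rewrite mulnDl.
  by apply: leq_add; [apply: leq_trans (H1 n) _|apply: leq_trans (H2 n) _];
    rewrite leq_mul2l leq_pexp2l ?leq_maxl ?leq_maxr ?orbT.
- exists (size (compile_expr e 0) + 2 + (C1 + C2)) => n /=; rewrite !mulnDl.
  have h1 : cost n c1 <= C1 * n.+1 ^ maxn (nesting c1) (nesting c2).
    by apply: leq_trans (H1 n) _; rewrite leq_mul2l leq_pexp2l ?leq_maxl ?orbT.
  have h2 : cost n c2 <= C2 * n.+1 ^ maxn (nesting c1) (nesting c2).
    by apply: leq_trans (H2 n) _; rewrite leq_mul2l leq_pexp2l ?leq_maxr ?orbT.
  have h3 : 0 < n.+1 ^ maxn (nesting c1) (nesting c2) by rewrite expn_gt0.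
  have h4 := leq_pmulr (size (compile_expr e 0)) h3; lia.
exists (C + 8) => n /=; rewrite expnS; have := H n; set q := n.+1 ^ _.
have q_gt0 : 0 < q by rewrite expn_gt0.
set y := cost n c => hy; have := leq_mul (leqnn n) hy.
have : n <= n * q by rewrite leq_pmulr.
nia.
Qed.

(** * Unit-cost flows and potentials *)

Lemma ltn_sum_one n (F F' : nat -> nat) k : k < n ->
  (forall i, i < n -> F i <= F' i) -> F k < F' k ->
  \sum_(i < n) F i < \sum_(i < n) F' i.
Proof.
move=> lt_kn leF ltF; rewrite (bigD1 (Ordinal lt_kn)) //=.
rewrite [X in _ < X](bigD1 (Ordinal lt_kn)) //=.
by rewrite -addSn; apply: leq_add => //; apply: leq_sum => i _; exact: leF.
Qed.

Lemma sum_indicator n a (b : bool) : a < n -> \sum_(i < n) ((i == a :> nat) && b) = b.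
Proof.
move=> lt_an; rewrite (bigD1 (Ordinal lt_an)) //= eqxx big1 ?addn0 // => i.
by rewrite -val_eqE /= => /negbTE->.
Qed.

Section Flow.

Variables (n : nat) (G : nat -> nat -> bool) (tg : nat -> nat).

Implicit Types (x : nat -> nat -> nat) (c d pi : nat -> nat).

Definition inflow x v := \sum_(u < n) x u v.
Definition outflow x v := \sum_(u < n) x v u.

(** Flow conservation without subtraction: x carries the configuration c to d. *)
Definition balanced x c d :=
  forall v, v < n -> c v + inflow x v = d v + outflow x v.

Definition increment x a b x' := forall u v, u < n -> v < n ->
  x' u v = x u v + ((u == a) && (v == b)).

Definition plus1 c a := fun v => c v + (v == a).

(** A unit added on the arc from a to b shifts a pending unit of supply from b to a. This moves the
    open end of an augmenting path backwards; read for a removed unit, it moves the tip of a walk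
    forwards. *)
Lemma balanced_increment x a b x' c d : a < n -> b < n -> increment x a b x' ->
  balanced x (plus1 c b) d <-> balanced x' (plus1 c a) d.
Proof.
move=> lt_a lt_b inc.
have inE v : v < n -> inflow x' v = inflow x v + (v == b).
  move=> lt_v; rewrite -(sum_indicator (v == b) lt_a) -big_split.
  by apply: eq_bigr => u _; rewrite inc.
have outE v : v < n -> outflow x' v = outflow x v + (v == a).
  move=> lt_v; rewrite -(sum_indicator (v == a) lt_b) -big_split.
  by apply: eq_bigr => u _; rewrite inc // andbC.
by split=> bal v lt_v; have := bal v lt_v; rewrite /plus1 inE // outE //; lia.
Qed.

Lemma eq_balanced x c d c' d' :
  (forall v, v < n -> c v + d' v = c' v + d v) ->
  balanced x c d -> balanced x c' d'.
Proof. by move=> eq_cd bal v lt_v; have := bal v lt_v; have := eq_cd v lt_v; lia. Qed.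

Definition lipschitz pi :=
  forall u v, u < n -> v < n -> G u v -> pi v <= (pi u).+1.

Definition tight pi x := forall u v, u < n -> v < n -> 0 < x u v ->
  G u v /\ pi v = (pi u).+1.

(** On the reverse of an arc carrying flow [tight] already fixes the change of pi, so only forward
    arcs are tested. *)
Definition admissible pi x u v := (0 < x v u) || G u v && (pi v == (pi u).+1).

Definition excess c v := tg v < c v.
Definition deficit c v := c v < tg v.

(** Flow runs along edges, where w is constant, so after exchanging the double sum the weighted
    inflows and outflows agree. With w = 1 this says that the number of tokens is preserved. *)
Lemma balanced_cut x pi c d (w : nat -> nat) : tight pi x ->
  (forall u v, u < n -> v < n -> G u v -> w u = w v) -> balanced x c d ->
  \sum_(v < n) w v * c v = \sum_(v < n) w v * d v.
Proof.
move=> tx inv_w bal.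
have : \sum_(v < n) w v * (c v + inflow x v) = \sum_(v < n) w v * (d v + outflow x v).
  by apply: eq_bigr => v _; rewrite bal.
under eq_bigr do rewrite mulnDr; under [in X in _ = X]eq_bigr do rewrite mulnDr.
rewrite !big_split /=.
suff -> : \sum_(v < n) w v * inflow x v = \sum_(v < n) w v * outflow x v.
  by move/addIn.
under eq_bigr do rewrite big_distrr; rewrite exchange_big /=.
apply: eq_bigr => u _; rewrite big_distrr; apply: eq_bigr => v _ /=.
case: (posnP (x u v)) => [->|x_gt0]; first by rewrite !muln0.
by rewrite (inv_w u v) //; case: (tx u v).
Qed.

Section PrimalDual.

Variable c0 : nat -> nat.

(** D counts the raises so far. Excess vertices are roots of the search and never raised; a raise
    occurs only when no deficit is reached, so it lifts every deficit. Hence the exact values 0 and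
    D. *)
Record primal_dual D cur x pi : Prop := PrimalDual {
  pd_cur : forall v, v < n -> cur v <= 1;
  pd_lip : lipschitz pi;
  pd_tight : tight pi x;
  pd_bal : balanced x c0 cur;
  pd_bound : forall v, v < n -> pi v <= D;
  pd_excess : forall v, v < n -> excess cur v -> pi v = 0;
  pd_deficit : forall v, v < n -> deficit cur v -> pi v = D }.

Hypothesis tg_le1 : forall v, v < n -> tg v <= 1.

(** R is the set of reached vertices. The Lipschitz bound could fail only on an edge leaving R along
    which pi already rises by one, but such an edge is admissible and its head lies in R. An arc
    carrying flow is admissible in both directions, so R contains both of its ends or neither, and
    it stays tight. *)
Lemma primal_dual_lift D cur x pi pi' (R : pred nat) :
  primal_dual D cur x pi ->
  (forall v, v < n -> excess cur v -> R v) ->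
  (forall v, v < n -> R v -> ~~ deficit cur v) ->
  (forall u v, u < n -> v < n -> R u -> admissible pi x u v -> R v) ->
  (forall v, v < n -> pi' v = pi v + ~~ R v) ->
  primal_dual D.+1 cur x pi'.
Proof.
move=> [cur1 lip tx bal bound exc def] excR defR closedR pi'E.
split=> //.
- move=> u v lt_u lt_v Guv; rewrite !pi'E //.
  have : R u -> pi v = (pi u).+1 -> R v.
    move=> Ru piv; apply: (closedR u v) => //.
    by rewrite /admissible Guv piv eqxx orbT.
  have := lip u v lt_u lt_v Guv.
  by case: (R u); case: (R v) => /=; lia.
- move=> u v lt_u lt_v xuv; have [Guv piv] := tx u v lt_u lt_v xuv; split=> //.
  have := closedR u v lt_u lt_v; have := closedR v u lt_v lt_u.
  rewrite /admissible xuv Guv piv eqxx orbT /= !pi'E // piv.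
  by case: (R u); case: (R v) => //; [move=> _ /(_ isT isT)|move=> /(_ isT isT)].
- by move=> v lt_v; rewrite pi'E //; have := bound v lt_v; case: (R v) => /=; lia.
- by move=> v lt_v ev; rewrite pi'E // excR // exc.
move=> v lt_v dv; rewrite pi'E // def //.
by case Rv: (R v); [have := defR v lt_v Rv; rewrite dv|rewrite addn1].
Qed.

(** Emptying s and filling t settles one excess and one deficit and creates none, so the conditions
    on their potentials are inherited. *)
Lemma primal_dual_augment D cur x pi x' cur' s t :
  primal_dual D cur x pi -> s < n -> t < n -> excess cur s -> deficit cur t ->
  tight pi x' -> balanced x' (plus1 c0 s) (plus1 cur t) ->
  (forall v, v < n -> cur' v = if v == t then 1 else if v == s then 0 else cur v) ->
  primal_dual D cur' x' pi /\
  \sum_(v < n) excess cur v = (\sum_(v < n) excess cur' v).+1.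
Proof.
move=> [cur1 lip tx bal bound exc def] lt_s lt_t es dt tx' bal' cur'E.
have cs := cur1 s lt_s; have ct := tg_le1 lt_t.
have ne_ts : t == s = false.
  by apply/eqP => e; move: es dt; rewrite /excess /deficit e; lia.
have exc' v : v < n -> excess cur' v = excess cur v && (v != s).
  move=> lt_v; rewrite /excess cur'E //; move: es dt; rewrite /excess /deficit.
  by case: (v =P t) => [->|_]; [lia|case: (v =P s) => [->|_]; lia].
have def' v : v < n -> deficit cur' v = deficit cur v && (v != t).
  move=> lt_v; rewrite /deficit cur'E //; move: es dt; rewrite /excess /deficit.
  by case: (v =P t) => [->|_]; [lia|case: (v =P s) => [->|_]; lia].
split; first split=> //.
- by move=> v lt_v; rewrite cur'E //; case: eqP => // _; case: eqP => // _; exact: cur1.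
- apply: eq_balanced bal' => v lt_v; rewrite /plus1 cur'E //.
  by move: es dt; rewrite /excess /deficit; case: (v =P t) => [->|_];
    [rewrite ne_ts; lia|case: (v =P s) => [->|_]; lia].
- by move=> v lt_v; rewrite exc' // => /andP[ev _]; exact: exc.
- by move=> v lt_v; rewrite def' // => /andP[dv _]; exact: def.
rewrite (bigD1 (Ordinal lt_s)) //= [in RHS](bigD1 (Ordinal lt_s)) //= es.
rewrite exc' // eqxx andbF; congr (_.+1); apply: eq_bigr => v ne_vs.
by rewrite exc' // -[val v != s]/(v != Ordinal lt_s) ne_vs andbT.
Qed.

(* When D reaches n, some level set {v | pi v = j} is empty and no edge
   crosses it, so the two sides of the level exchange no token. *)
Lemma primal_dual_cut D cur x pi :
  symmetric G -> primal_dual D cur x pi -> n <= D ->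
  ~~ [forall v : 'I_n, cur v == tg v] ->
  exists2 w : nat -> nat,
    (forall u v, u < n -> v < n -> G u v -> w u = w v) &
    \sum_(v < n) w v * c0 v != \sum_(v < n) w v * tg v.
Proof.
move=> symG [cur1 lip tx bal bound exc def] le_nD /forallPn[b bad_b].
case: (pickP (fun t : 'I_n => deficit cur t)) => [t dt|no_def]; last first.
  (* Without a deficit the two configurations differ in their number of tokens, and the constant
     weight separates them. *)
  exists (fun=> 1) => //; rewrite (balanced_cut (w := fun=> 1) tx _ bal) //.
  rewrite neq_ltn; apply/orP; right.
  have cur_tg i : i < n -> tg i <= cur i.
    by move=> lt_i; have := no_def (Ordinal lt_i); rewrite /deficit /=; lia.
  apply: (@ltn_sum_one n (fun i => 1 * tg i) (fun i => 1 * cur i) b) => //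
    [i lt_i|]; rewrite !mul1n; first exact: cur_tg.
  by rewrite ltn_neqAle eq_sym bad_b cur_tg.
(* Pigeonhole: n vertices cannot take all of the n + 1 values 0, ..., n. *)
have [j j_le j_out] : exists2 j, j <= n & forall v, v < n -> pi v != j.
  have : ~~ all (mem (map pi (iota 0 n))) (iota 0 n.+1).
    apply/negP => /allP sub.
    have := uniq_leq_size (iota_uniq 0 n.+1) sub.
    by rewrite size_map !size_iota ltnn.
  case/allPn=> j; rewrite mem_iota => /= j_le j_out; exists j => // v lt_v.
  by apply: contra j_out => /eqP <-; apply: map_f; rewrite mem_iota.
have inv_w u v : u < n -> v < n -> G u v -> (j < pi u : nat) = (j < pi v).
  move=> lt_u lt_v Guv; have Gvu : G v u by rewrite symG.
  have := lip u v lt_u lt_v Guv; have := lip v u lt_v lt_u Gvu.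
  by move: (j_out u lt_u) (j_out v lt_v); lia.
(* No excess lies above the empty level, as its potential is 0, whereas every deficit does, as D >=
   n >= j and D is not j. *)
exists (fun v => j < pi v : nat) => //.
rewrite (balanced_cut (w := fun v => j < pi v : nat) tx _ bal) //.
rewrite neq_ltn; apply/orP; left; apply: (@ltn_sum_one n (fun i => (j < pi i) * cur i)
    (fun i => (j < pi i) * tg i) t) => // [i lt_i|].
  case: ltnP => // j_lt; rewrite !mul1n leqNgt; apply/negP => ei.
  by move: (exc i lt_i ei) j_lt => ->.
have -> : j < pi t; last by rewrite !mul1n.
by rewrite def //; move: (j_out t (ltn_ord t)); rewrite def //; lia.
Qed.

End PrimalDual.

(** Here c <= tg at every vertex, and the flow makes the two totals equal. *)
Lemma balanced_no_excess x pi c : tight pi x -> balanced x c tg ->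
  (forall v, v < n -> ~~ excess c v) -> forall v, v < n -> c v = tg v.
Proof.
move=> tx bal no_exc v lt_v; apply/eqP; rewrite eqn_leq leqNgt (no_exc v lt_v) /=.
rewrite leqNgt; apply/negP => lt_cv.
have := @ltn_sum_one n (fun i => 1 * c i) (fun i => 1 * tg i) v lt_v.
rewrite (balanced_cut (w := fun=> 1) tx _ bal) // ltnn => H; suff : false by [].
by apply: H; rewrite ?mul1n // => i lt_i; rewrite !mul1n leqNgt no_exc.
Qed.

End Flow.

(** * Reasoning about loop programs *)

Lemma ev_skip n s : ev n Skip s = s. Proof. by []. Qed.
Lemma ev_asg n x e s : ev n (Asg x e) s = set_reg s x (eval n e s).
Proof. by []. Qed.
Lemma ev_put n a e1 e2 s :
  ev n (Put a e1 e2) s = set_arr s a (eval n e1 s) (eval n e2 s).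
Proof. by []. Qed.
Lemma ev_seq n c1 c2 s : ev n (Seq c1 c2) s = ev n c2 (ev n c1 s).
Proof. by []. Qed.
Lemma ev_if n e c1 c2 s :
  ev n (If e c1 c2) s = if eval n e s == 0 then ev n c2 s else ev n c1 s.
Proof. by []. Qed.
Lemma ev_for n x c s : ev n (For x c) s =
  set_reg (foldl (fun s i => ev n c (set_reg s x i)) s (iota 0 n)) x n.
Proof. by []. Qed.
Definition evE := (ev_skip, ev_asg, ev_put, ev_seq, ev_if).

#[global] Opaque ev.

(** The body may also use that everything outside the write set of the loop is as it was on entry,
    so invariants need to mention only what changes. *)
Lemma for_rule (I : nat -> state -> Prop) n x c s : I 0 s ->
  (forall i s', i < n -> frame (For x c) s s' -> I i s' ->
     I i.+1 (ev n c (set_reg s' x i))) ->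
  exists s', [/\ ev n (For x c) s = set_reg s' x n, frame (For x c) s s' & I n s'].
Proof.
move=> I0 IS.
suff [s' [E fr In]] : exists s', [/\ foldl (fun s i => ev n c (set_reg s x i)) s
    (iota 0 n) = s', frame (For x c) s s' & I n s'].
  by exists s'; split=> //; rewrite ev_for E.
have : forall k i s1, i + k = n -> frame (For x c) s s1 -> I i s1 ->
    exists s', [/\ foldl (fun s i => ev n c (set_reg s x i)) s1 (iota i k) = s',
      frame (For x c) s s' & I n s'].
  elim=> [|k IHk] i s1 eq_n fr Ii.
    by exists s1; split=> //; rewrite -eq_n addn0.
  apply: IHk; [by rewrite addSnnS| |by apply: IS => //; lia].
  apply: frame_trans fr _; apply: frame_trans (frame_set_reg _ c _ i) _.
  have [r a] := frame_ev n c (set_reg s1 x i); split=> // y.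
  by rewrite inE negb_or => /andP[_ /r].
by move/(_ n 0 s (add0n n)); apply.
Qed.

(** Gives 2n iterations. The counter restarts halfway, so the invariants used with it must not
    depend on the loop register. *)
Definition Twice x c := Seq (For x c) (For x c).

Lemma twice_rule (I : nat -> state -> Prop) n x c s :
  (forall i s' v, I i s' -> I i (set_reg s' x v)) -> I 0 s ->
  (forall i s', i < n + n -> frame (Twice x c) s s' -> I i s' ->
     I i.+1 (ev n c s')) ->
  I (n + n) (ev n (Twice x c) s).
Proof.
move=> Ix I0 IS; rewrite ev_seq.
have sub s1 s2 : frame (For x c) s1 s2 -> frame (Twice x c) s1 s2.
  by move=> [r a]; split=> z; rewrite mem_cat negb_or => /andP[hz _];
    [exact: r|exact: a].
have set_x s1 s2 v : frame (Twice x c) s1 s2 -> frame (Twice x c) s1 (set_reg s2 x v).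
  by move=> fr; apply: frame_trans fr (sub _ _ (frame_set_reg _ _ _ _)).
have [|s1 [-> fr1 I1]] := @for_rule I n x c s I0.
  move=> i s' lt_i /sub fr /Ix Ii; apply: IS (Ii i); first by lia.
  exact: set_x.
have [||s2 [-> fr2 I2]] := @for_rule (fun i => I (n + i)) n x c (set_reg s1 x n).
- by rewrite addn0; exact: Ix.
- move=> i s' lt_i /sub fr /Ix Ii; rewrite addnS; apply: IS (Ii i); first by lia.
  by apply/(set_x)/(frame_trans _ fr)/(set_x)/(sub).
exact: Ix.
Qed.

(** * The program *)

Notation "e1 '[+]' e2" := (Plus e1 e2) (at level 50, left associativity).
Notation "e1 '[-]' e2" := (Minus e1 e2) (at level 50, left associativity).
Notation "c1 ';;' c2" := (Seq c1 c2) (at level 61, right associativity).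
Notation "x '::=' e" := (Asg x e) (at level 60).

Notation rLen := 13 (only parsing).
Notation rAcc := 3 (only parsing).
Notation rI := 4 (only parsing).
Notation rH := 5 (only parsing).
Notation rV := 6 (only parsing).
Notation rTail := 7 (only parsing).
Notation rU := 8 (only parsing).
Notation rB := 9 (only parsing).
Notation rT := 10 (only parsing).
Notation rW := 11 (only parsing).
Notation rOk := 12 (only parsing).
Notation rTop := 14 (only parsing).
Notation rAct := 15 (only parsing).

(* aRow tabulates i * n, since the RAM has no multiplication.  aCur is the
   configuration reached by the flow aX, aConf the one reached by the swaps
   emitted so far. *)
Notation aIn := 0 (only parsing).
Notation aRow := 1 (only parsing).
Notation aCur := 2 (only parsing).
Notation aTg := 3 (only parsing).
Notation aPi := 4 (only parsing).
Notation aX := 5 (only parsing).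
Notation aPar := 6 (only parsing).
Notation aQ := 7 (only parsing).
Notation aConf := 8 (only parsing).
Notation aPath := 9 (only parsing).
Notation aOut := 10 (only parsing).

Definition adj u v := Get aIn (Cst 2 [+] Get aRow u [+] v).
Definition entry u v := Get aRow u [+] v.
(** The absolute difference, as subtraction is truncated. *)
Definition neq e1 e2 := (e1 [-] e2) [+] (e2 [-] e1).

(** Parents are stored as vertex plus one, 0 meaning unreached; a root is its own parent. *)
Definition seed :=
  rTail ::= Cst 0 ;;
  For rV
    (If (Get aCur (Var rV) [-] Get aTg (Var rV))
       (Put aPar (Var rV) (Var rV [+] Cst 1) ;;
        Put aQ (Var rTail) (Var rV) ;;
        rTail ::= Var rTail [+] Cst 1)
       (Put aPar (Var rV) (Cst 0))).

Definition test_arc :=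
  rB ::= Get aX (entry (Var rV) (Var rU)) ;;
  If (adj (Var rU) (Var rV))
    (If (neq (Get aPi (Var rV)) (Get aPi (Var rU) [+] Cst 1)) Skip
       (rB ::= Cst 1))
    Skip.

Definition visit :=
  If (Get aPar (Var rV)) Skip
    (test_arc ;;
     If (Var rB)
       (Put aPar (Var rV) (Var rU [+] Cst 1) ;;
        Put aQ (Var rTail) (Var rV) ;;
        rTail ::= Var rTail [+] Cst 1)
       Skip).

(** Breadth-first search as a loop over queue positions; a position at or beyond the current tail
    means that the queue is exhausted, and it is skipped. *)
Definition scan :=
  For rH
    (If (Var rTail [-] Var rH)
       (rU ::= Get aQ (Var rH) ;; For rV visit)
       Skip).

Definition find_deficit :=
  rT ::= Cst 0 ;;
  For rV
    (If (Get aPar (Var rV))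
       (If (Get aTg (Var rV) [-] Get aCur (Var rV)) (rT ::= Var rV [+] Cst 1) Skip)
       Skip).

(** Parents are followed from the deficit to its root, each arc either cancelling a unit of opposite
    flow or gaining one. At the root the parent is the vertex itself and the remaining iterations
    idle. *)
Definition augment :=
  rU ::= Var rT [-] Cst 1 ;;
  For rH
    (rV ::= Get aPar (Var rU) [-] Cst 1 ;;
     If (neq (Var rV) (Var rU))
       (If (Get aX (entry (Var rU) (Var rV)))
          (Put aX (entry (Var rU) (Var rV))
             (Get aX (entry (Var rU) (Var rV)) [-] Cst 1))
          (Put aX (entry (Var rV) (Var rU))
             (Get aX (entry (Var rV) (Var rU)) [+] Cst 1)) ;;
        rU ::= Var rV)
       Skip) ;;
  Put aCur (Var rU) (Cst 0) ;;
  Put aCur (Var rT [-] Cst 1) (Cst 1).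

Definition raise_unreached :=
  For rV
    (If (Get aPar (Var rV)) Skip
       (Put aPi (Var rV) (Get aPi (Var rV) [+] Cst 1))).

Definition improve :=
  seed ;; scan ;; find_deficit ;; If (Var rT) augment raise_unreached.

(** * Correctness of the search *)

Section Search.

Variables (n : nat) (G : nat -> nat -> bool).

Definition layout s :=
  (forall i, i < n -> arr s aRow i = i * n) /\
  (forall u v, u < n -> v < n -> arr s aIn (2 + u * n + v) = G u v).

Definition mat (a : nat -> nat) u v := a (u * n + v).

Lemma mat_upd a u v k x y : v < n -> y < n ->
  mat (upd a (u * n + v) k) x y = if (x == u) && (y == v) then k else mat a x y.
Proof.
move=> lt_v lt_y; rewrite /mat /upd; congr (if _ then _ else _).
apply/eqP/andP => [eq_xy|[/eqP-> /eqP->] //].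
have := congr1 (divn^~ n) eq_xy; have := congr1 (modn^~ n) eq_xy.
have n_gt0 : 0 < n by exact: leq_ltn_trans lt_v.
by rewrite /= !modnMDl !divnMDl // !modn_small // !divn_small // !addn0 => -> ->.
Qed.

Variables (cur tg pi : nat -> nat) (x : nat -> nat -> nat).

(** Parents other than the root's own stand strictly earlier in the queue; this makes parent chains
    acyclic and shorter than n. *)
Definition linked (par : nat -> nat) (q : seq nat) :=
  [/\ uniq q, forall v, v \in q -> v < n
    & forall i, i < size q -> let v := nth 0 q i in
        (par v = v.+1 /\ excess tg cur v) \/
        (exists2 j, j < i & par v = (nth 0 q j).+1 /\ admissible G pi x (nth 0 q j) v)].

Definition marked m (par : nat -> nat) (q : seq nat) :=
  forall v, v < m -> (par v != 0) = (v \in q).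

Definition queued s (q : seq nat) :=
  reg s rTail = size q /\ forall i, i < size q -> arr s aQ i = nth 0 q i.

Lemma linked_rcons par q v p : linked par q -> v < n -> v \notin q ->
  (p = v.+1 /\ excess tg cur v) \/
  (exists2 u, u \in q & p = u.+1 /\ admissible G pi x u v) ->
  linked (upd par v p) (rcons q v).
Proof.
move=> [uq lt_q link] lt_v v_q new; split=> [|w|i].
- by rewrite rcons_uniq v_q.
- by rewrite mem_rcons inE => /predU1P[->|/lt_q].
rewrite size_rcons ltnS leq_eqVlt => /predU1P[->|lt_i] /=.
  rewrite nth_rcons ltnn eqxx upd_eq; case: new => [new|[u u_q up]]; [by left|right].
  exists (index u q); first by rewrite index_mem.
  by rewrite nth_rcons index_mem u_q nth_index.
rewrite nth_rcons lt_i upd_neq; last by apply: contraNneq v_q => <-; rewrite mem_nth.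
case: (link i lt_i) => [|[j lt_j jp]]; [by left|right].
by exists j => //; rewrite nth_rcons (ltn_trans lt_j).
Qed.

Lemma marked_rcons m par q v p : marked m par q -> p != 0 ->
  marked m (upd par v p) (rcons q v).
Proof.
move=> mk p0 w lt_w; rewrite mem_rcons inE /upd.
by case: (w =P v) => [_|_]; [exact: p0|exact: mk].
Qed.

Lemma queued_rcons s s' q v : queued s q -> reg s' rTail = (size q).+1 ->
  arr s' aQ = upd (arr s aQ) (size q) v -> queued s' (rcons q v).
Proof.
move=> [_ hq] eT E; split=> [|i]; first by rewrite eT size_rcons.
rewrite size_rcons ltnS nth_rcons E /upd; case: ltngtP => // lt_i _.
exact: hq.
Qed.

Lemma seed_ok s : arr s aCur = cur -> arr s aTg = tg ->
  let s' := ev n seed s in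
  exists q, [/\ queued s' q, linked (arr s' aPar) q, marked n (arr s' aPar) q
    & forall v, v < n -> excess tg cur v -> v \in q].
Proof.
move=> eC eT /=; rewrite /seed !evE /=.
pose I i s' := exists q, [/\ queued s' q, linked (arr s' aPar) q,
  marked i (arr s' aPar) q,
  forall v, v \in q -> v < i & forall v, v < i -> excess tg cur v -> v \in q].
set c := If _ _ _.
have [||s' [-> fr [q [h1 h2 h3 _ h5]]]] := @for_rule I n rV c (set_reg s rTail 0).
- by exists [::].
- move=> i s1 lt_i fr [q [[qT qQ] lk mk lt_q ex]].
  have i_q : i \notin q by apply: contraFN (ltnn i); exact: lt_q.
  rewrite /c !evE /= (fr.2 aCur isT) (fr.2 aTg isT) /= eC eT.
  case: eqP => [ne|e]; rewrite /I /=.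
    exists q; split=> //=.
    + split; case: lk => // uq lt_qn link j lt_j /=.
      have ne_ij : nth 0 q j != i by apply: contraNneq i_q => <-; rewrite mem_nth.
      by rewrite upd_neq //; exact: link.
    + move=> v; rewrite ltnS leq_eqVlt /upd => /predU1P[->|lt_v].
        by rewrite eqxx (negbTE i_q).
      by rewrite (ltn_eqF lt_v) mk.
    + by move=> v /lt_q; lia.
    + move=> v; rewrite ltnS leq_eqVlt => /predU1P[->|]; last exact: ex.
      by rewrite /excess; lia.
  exists (rcons q i); split=> //=.
  + by apply: queued_rcons (conj qT qQ) _ _ => /=; rewrite ?qT ?addn1.
  + by apply: linked_rcons => //; left; rewrite addn1 /excess; lia.
  + move=> v; rewrite ltnS leq_eqVlt mem_rcons inE /upd => /predU1P[->|lt_v].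
      by rewrite eqxx addn1.
    by rewrite (ltn_eqF lt_v) mk.
  + by move=> v; rewrite mem_rcons inE => /predU1P[->|/lt_q]; lia.
  + move=> v; rewrite ltnS leq_eqVlt mem_rcons inE => /predU1P[->|lt_v ev_v].
      by rewrite eqxx.
    by rewrite (ex v lt_v ev_v) orbT.
by exists q.
Qed.

Lemma test_arc_ok s u v : u < n -> v < n -> layout s ->
  arr s aPi = pi -> mat (arr s aX) = x -> reg s rU = u -> reg s rV = v ->
  (reg (ev n test_arc s) rB != 0) = admissible G pi x u v.
Proof.
move=> lt_u lt_v [row adjE] ePi eX eu ev.
rewrite /test_arc /entry /adj /neq !evE /= eu ev (row u) // adjE // ePi.
rewrite /admissible -eX /mat row // lt0n.
case: (G u v) => /=; last by rewrite orbF.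
case: (pi v =P (pi u).+1) => [->|ne] /=.
  by rewrite addn1 subnn /= orbT.
by have -> : pi v - (pi u + 1) + (pi u + 1 - pi v) == 0 = false by [lia]; rewrite orbF.
Qed.

Lemma layout_frame s s' : arr s' aRow = arr s aRow -> arr s' aIn = arr s aIn ->
  layout s -> layout s'.
Proof. by rewrite /layout => -> ->. Qed.

Lemma linked_size par q : linked par q -> size q <= n.
Proof.
move=> [uq lt_q _]; rewrite -(size_iota 0 n); apply: uniq_leq_size => // v /lt_q.
by rewrite mem_iota.
Qed.

Lemma visit_ok s u q : layout s -> arr s aPi = pi -> mat (arr s aX) = x ->
  reg s rU = u -> u \in q ->
  queued s q -> linked (arr s aPar) q -> marked n (arr s aPar) q ->
  exists r, let s' := ev n (For rV visit) s in
  [/\ queued s' (q ++ r), linked (arr s' aPar) (q ++ r),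
      marked n (arr s' aPar) (q ++ r)
    & forall v, v < n -> admissible G pi x u v -> v \in q ++ r].
Proof.
move=> lay ePi eX eu u_q qu lk mk.
have lt_u : u < n by case: lk => _ /(_ u u_q).
pose I i s' := exists r, [/\ queued s' (q ++ r), linked (arr s' aPar) (q ++ r),
  marked n (arr s' aPar) (q ++ r)
  & forall v, v < i -> admissible G pi x u v -> v \in q ++ r].
have [||s' [-> fr [r [h1 h2 h3 h4]]]] := @for_rule I n rV visit s.
- by exists [::]; rewrite cats0.
- move=> i s1 lt_i fr [r [qu1 lk1 mk1 cl1]].
  have lay1 := layout_frame (fr.2 aRow isT) (fr.2 aIn isT) lay.
  rewrite /visit evE; set s2 := set_reg s1 rV i.
  have -> : eval n (Get aPar (Var rV)) s2 = arr s1 aPar i by [].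
  case: eqP => [par_i|/eqP par_i]; last first.
    exists r; split=> // v; rewrite ltnS leq_eqVlt => /predU1P[->|]; last exact: cl1.
    by rewrite -mk1.
  have i_q : i \notin q ++ r by rewrite -mk1 // par_i.
  have := @test_arc_ok s2 u i lt_u lt_i lay1.
  rewrite /= (fr.2 aPi isT) (fr.2 aX isT) (fr.1 rU isT) => /(_ ePi eX eu erefl).
  have fr3 := frame_ev n test_arc s2; rewrite evE.
  set s3 := ev n test_arc s2 in fr3 * => adm_b; rewrite evE /= -if_neg adm_b.
  case: ifP => adm_i; last first.
    rewrite evE; exists r; split=> //.
    + by case: qu1 => h1 h2; split; rewrite ?(fr3.1 rTail isT) ?(fr3.2 aQ isT).
    + by rewrite (fr3.2 aPar isT).
    + by rewrite (fr3.2 aPar isT).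
    + move=> v; rewrite ltnS leq_eqVlt => /predU1P[->|]; last exact: cl1.
      by rewrite adm_i.
  rewrite !evE /=; exists (rcons r i); rewrite -rcons_cat.
  have [qT qQ] := qu1.
  rewrite (fr3.1 rU isT) (fr3.1 rV isT) /= (fr.1 rU isT) eu.
  split=> //=.
  + by apply: queued_rcons qu1 _ _ => /=;
      rewrite (fr3.1 rTail isT) /= qT ?addn1 ?(fr3.2 aQ isT).
  + rewrite (fr3.2 aPar isT); apply: linked_rcons => //; right.
    by exists u; rewrite ?mem_cat ?u_q ?addn1.
  + by rewrite (fr3.2 aPar isT); apply: marked_rcons; rewrite ?addn1.
  + move=> v; rewrite ltnS leq_eqVlt mem_rcons inE => /predU1P[->|lt_v adm_v].
      by rewrite eqxx.
    by rewrite cl1 ?orbT.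
by exists r.
Qed.

Lemma scan_ok s q0 : layout s -> arr s aPi = pi -> mat (arr s aX) = x ->
  queued s q0 -> linked (arr s aPar) q0 -> marked n (arr s aPar) q0 ->
  exists r, let s' := ev n scan s in let q := q0 ++ r in
  [/\ queued s' q, linked (arr s' aPar) q, marked n (arr s' aPar) q
    & forall u v, u \in q -> v < n -> admissible G pi x u v -> v \in q].
Proof.
move=> lay ePi eX qu lk mk; rewrite /scan; set c := If _ _ _.
pose I i s' := exists r, let q := q0 ++ r in
  [/\ queued s' q, linked (arr s' aPar) q, marked n (arr s' aPar) q
    & forall k v, k < i -> k < size q -> v < n ->
        admissible G pi x (nth 0 q k) v -> v \in q].
have [||s' [-> fr [r [h1 h2 h3 h4]]]] := @for_rule I n rH c s.
- by exists [::]; rewrite /= cats0.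
- move=> i s1 lt_i fr [r]; set q := q0 ++ r => -[qu1 lk1 mk1 cl1].
  have [qT qQ] := qu1.
  rewrite /c evE /= qT; case: eqP => [le_i|gt_i].
    rewrite evE; exists r; split=> // k v; rewrite ltnS leq_eqVlt => /predU1P[->|].
      by move=> lt_iq; move/eqP: le_i; rewrite subn_eq0 leqNgt lt_iq.
    exact: cl1.
  have lt_iq : i < size q by lia.
  rewrite !evE /= qQ //; set s2 := set_reg _ rU _.
  have [||||||||r' [h1 h2 h3 h4]] := @visit_ok s2 (nth 0 q i) q; rewrite /s2 //=.
  + exact: layout_frame (fr.2 aRow isT) (fr.2 aIn isT) lay.
  + by rewrite (fr.2 aPi isT).
  + by rewrite (fr.2 aX isT).
  + by rewrite mem_nth.
  exists (r ++ r'); rewrite /= catA; split=> // k v lt_k lt_kq lt_v.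
  move: lt_k; rewrite ltnS leq_eqVlt nth_cat => /predU1P[->|lt_k].
    by rewrite lt_iq; exact: h4.
  have lt_kq' := ltn_trans lt_k lt_iq.
  by rewrite lt_kq' mem_cat => /(cl1 k v lt_k lt_kq' lt_v) ->.
(* A duplicate-free queue of vertices has at most n entries, so the n iterations have scanned all of
   it. *)
exists r; split=> // u v u_q lt_v adm.
have lt_k : index u (q0 ++ r) < size (q0 ++ r) by rewrite index_mem.
by apply: (h4 (index u (q0 ++ r))); rewrite ?nth_index // (leq_trans lt_k) ?(linked_size h2).
Qed.

End Search.

(** * Correctness of a round and of the optimization *)

Section Improve.

Variables (n : nat) (G : nat -> nat -> bool) (tg c0 : nat -> nat).

Lemma find_deficit_ok s : arr s aTg = tg -> let t := reg (ev n find_deficit s) rT in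
  (t = 0 /\ forall v, v < n -> arr s aPar v != 0 -> ~~ deficit tg (arr s aCur) v) \/
  [/\ t.-1 < n, t != 0, arr s aPar t.-1 != 0 & deficit tg (arr s aCur) t.-1].
Proof.
move=> eT; rewrite /find_deficit; set c := If _ _ _; rewrite !evE /=.
pose I i s' := let t := reg s' rT in
  (t = 0 /\ forall v, v < i -> arr s aPar v != 0 -> ~~ deficit tg (arr s aCur) v) \/
  [/\ t.-1 < n, t != 0, arr s aPar t.-1 != 0 & deficit tg (arr s aCur) t.-1].
have [||s' [-> fr In]] := @for_rule I n rV c (set_reg s rT 0).
- by left.
- move=> i s1 lt_i fr Ii.
  rewrite /c !evE /= (fr.2 aPar isT) (fr.2 aTg isT) (fr.2 aCur isT) /= eT.
  have skip : (arr s aPar i != 0 -> ~~ deficit tg (arr s aCur) i) ->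
      I i.+1 (set_reg s1 rV i).
    move=> no_i; case: Ii => [[t0 Ii]|]; [left|by right].
    by split=> // v; rewrite ltnS leq_eqVlt => /predU1P[->|]; [exact: no_i|exact: Ii].
  case: eqP => [par_i|/eqP par_i]; first by apply: skip; rewrite par_i.
  case: eqP => [no_def|def]; first by apply: skip; rewrite /deficit; lia.
  by right; rewrite /= addn1 /=; split=> //; rewrite /deficit; lia.
exact: In.
Qed.

Lemma raise_unreached_ok s v : arr (ev n raise_unreached s) aPi v =
  arr s aPi v + ((v < n) && (arr s aPar v == 0)).
Proof.
rewrite /raise_unreached; set c := If _ _ _.
pose I i s' := forall v, arr s' aPi v = arr s aPi v + ((v < i) && (arr s aPar v == 0)).
have [||s' [-> fr In]] := @for_rule I n rV c s; last exact: In.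
  by move=> w; rewrite addn0.
move=> i s1 lt_i fr Ii; rewrite /c !evE /= (fr.2 aPar isT).
case: eqP => [par_i|/eqP par_i] w /=.
  rewrite /upd ltnS leq_eqVlt; case: (w =P i) => [->|_] /=; last exact: Ii.
  by rewrite Ii ltnn par_i addn0.
rewrite Ii ltnS [in RHS]leq_eqVlt.
by case: (w =P i) => [->|_] /=; rewrite ?(negbTE par_i) ?andbF.
Qed.

Lemma increment_upd (a : nat -> nat) u v : u < n -> v < n ->
  increment n (mat n a) u v (mat n (upd a (u * n + v) (a (u * n + v) + 1))).
Proof.
move=> lt_u lt_v x y lt_x lt_y; rewrite mat_upd //.
by case: ifP => [/andP[/eqP-> /eqP->]|_]; rewrite ?addn0.
Qed.

Lemma decrement_upd (a : nat -> nat) u v : u < n -> v < n -> 0 < a (u * n + v) ->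
  increment n (mat n (upd a (u * n + v) (a (u * n + v) - 1))) u v (mat n a).
Proof.
move=> lt_u lt_v a_gt0 x y lt_x lt_y; rewrite mat_upd //.
case: ifP => [/andP[/eqP-> /eqP->]|_]; rewrite ?addn0 // /mat; lia.
Qed.

Lemma tight_decrement pi x x' u v : increment n x' u v x -> tight n G pi x ->
  tight n G pi x'.
Proof.
move=> inc tx a b lt_a lt_b x_gt0; apply: tx => //.
by rewrite inc // ltn_addr.
Qed.

Lemma tight_increment pi x x' u v : increment n x u v x' -> tight n G pi x ->
  G u v -> pi v = (pi u).+1 -> tight n G pi x'.
Proof.
move=> inc tx Guv piv a b lt_a lt_b; rewrite inc //.
by case: andP => [[/eqP-> /eqP->] //|_]; rewrite addn0; exact: tx.
Qed.

(** At path vertex u the flow carries one additional unit from u to t. Initially u = t and the two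
    extra units cancel; each parent step moves u by [balanced_increment]. Its queue position drops
    each time, so n iterations reach the root. *)
Lemma augment_ok s q t : layout n G s -> let cur := arr s aCur in
  let pi := arr s aPi in let x := mat n (arr s aX) in let s' := ev n augment s in
  linked n G cur tg pi x (arr s aPar) q -> t \in q -> reg s rT = t.+1 ->
  tight n G pi x -> balanced n x c0 cur ->
  exists r, [/\ r < n, excess tg cur r, tight n G pi (mat n (arr s' aX)),
    balanced n (mat n (arr s' aX)) (plus1 c0 r) (plus1 cur t) &
    forall v, v < n -> arr s' aCur v = if v == t then 1 else if v == r then 0 else cur v].
Proof.
move=> lay cur pi x /= lk t_q eT tx bal.
have [uq lt_q link] := lk; have size_q := linked_size lk.
rewrite /augment; set c := _ ;; If _ _ _; rewrite !evE /= eT subn1 /=.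
pose parent x' k := let v := nth 0 q k in
  (arr s aPar v = v.+1 /\ excess tg cur v) \/
  (exists2 j, j < k & arr s aPar v = (nth 0 q j).+1 /\
                      admissible G pi x' (nth 0 q j) v).
pose I i s' := exists k, [/\ k < size q /\ reg s' rU = nth 0 q k,
  tight n G pi (mat n (arr s' aX)),
  balanced n (mat n (arr s' aX)) (plus1 c0 (nth 0 q k)) (plus1 cur t),
  forall k', k' <= k -> parent (mat n (arr s' aX)) k' &
  arr s aPar (nth 0 q k) = (nth 0 q k).+1 \/ i + k < n].
have lt_nth k : k < size q -> nth 0 q k < n by move=> lt_k; apply/lt_q/mem_nth.
have [||s' [-> fr [k [[lt_k eU] tx' bal' par' rk]]]] :=
    @for_rule I n rH c (set_reg s rU t).
- exists (index t q); rewrite /= index_mem nth_index //; split=> //.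
  + by apply: eq_balanced bal => v _; rewrite /plus1; lia.
  + by move=> k' le_k; apply: link; rewrite (leq_ltn_trans le_k) ?index_mem.
  by right; rewrite (leq_trans _ size_q) ?index_mem.
- move=> i s1 lt_i fr [k [[lt_k eU] tx1 bal1 par1 rk]].
  have [row _] := layout_frame (fr.2 aRow isT) (fr.2 aIn isT) lay.
  have lt_u := lt_nth k lt_k.
  rewrite /c /neq /entry !evE /= (fr.2 aPar isT) /= !eU !(row _ lt_u).
  set u := nth 0 q k in eU lt_u bal1 rk *.
  case: (par1 k (leqnn k)) => [[root _]|[j lt_jk [par_u adm]]].
    rewrite root subn1 /= !subnn /=; exists k; split=> //; by left.
  rewrite par_u subn1 /=; rewrite -/u in par_u adm; set p := nth 0 q j in par_u adm *.
  have lt_j : j < size q by exact: ltn_trans lt_k.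
  have lt_p : p < n by exact: lt_nth.
  have ne_u k' : k' < k -> nth 0 q k' != u.
    by move=> lt_k'; rewrite nth_uniq ?(ltn_trans lt_k') // ltn_eqF.
  have ne_pu : p != u by exact: ne_u.
  have -> : p - u + (u - p) == 0 = false by lia.
  (* A step changes only an arc at u. The vertices still ahead stand earlier in the queue and differ
     from u, so their parent arcs remain admissible. *)
  have other x' x'' k' : (forall a b, a < n -> b < n -> a != u -> b != u ->
      x'' a b = x' a b) -> k' <= j -> parent x' k' -> parent x'' k'.
    move=> same le_k' [pr|[j' lt_j' [pr adm']]]; [by left|right; exists j' => //].
    have lt_k' : k' < size q by exact: leq_ltn_trans lt_j.
    have lt_j'q : j' < size q by exact: ltn_trans lt_k'.
    have lt_k'k := leq_ltn_trans le_k' lt_jk.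
    by split=> //; rewrite /admissible same ?lt_nth ?ne_u // (ltn_trans lt_j').
  rewrite (row p) //; case: eqP => [x0|/eqP x_gt0].
    move: adm; rewrite /admissible /mat x0 /= => /andP[Gpu /eqP piu].
    have inc := increment_upd (arr s1 aX) lt_p lt_u.
    exists j; split=> //=.
    + exact: tight_increment inc tx1 Gpu piu.
    + by apply/(balanced_increment _ _ lt_p lt_u inc).
    + move=> k' le_k'; have le_k'k := ltnW (leq_ltn_trans le_k' lt_jk).
      apply: other le_k' (par1 k' le_k'k).
      by move=> a b lt_a lt_b _ ne_b; rewrite mat_upd // (negbTE ne_b) andbF.
    + by right; lia.
  rewrite -lt0n in x_gt0; have dec := decrement_upd lt_u lt_p x_gt0.
  exists j; split=> //=.
  + exact: tight_decrement dec tx1.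
  + by apply/(balanced_increment _ _ lt_u lt_p dec).
  + move=> k' le_k'; have le_k'k := ltnW (leq_ltn_trans le_k' lt_jk).
      apply: other le_k' (par1 k' le_k'k).
    by move=> a b lt_a lt_b ne_a _; rewrite mat_upd // (negbTE ne_a).
  + by right; lia.
exists (nth 0 q k); rewrite /= eU (fr.1 rT isT) /= eT subn1 /=.
split=> //; first exact: lt_nth.
  case: (par' k (leqnn k)) => [[]//|[j lt_jk [par_u _]]].
  case: rk => [root|]; last by lia.
  move: par_u; rewrite root => -[] /eqP; rewrite nth_uniq //; first by lia.
  exact: ltn_trans lt_k.
by move=> v lt_v; rewrite (fr.2 aCur isT).
Qed.

Definition flow_state D s :=
  [/\ layout n G s, arr s aTg = tg &
      primal_dual n G tg c0 D (arr s aCur) (mat n (arr s aX)) (arr s aPi)].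

Definition excess_count s := \sum_(v < n) excess tg (arr s aCur) v.

Hypothesis tg_le1 : forall v, v < n -> tg v <= 1.

(** Every round makes progress in D or in the number of excesses, even after the target is met: then
    nothing is reached and all vertices are raised. *)
Lemma improve_ok D s : flow_state D s -> let s' := ev n improve s in
  (flow_state D.+1 s' /\ excess_count s' = excess_count s) \/
  (flow_state D s' /\ excess_count s = (excess_count s').+1).
Proof.
move=> [lay eT pd]; rewrite /improve (ev_seq _ seed) (ev_seq _ scan).
rewrite (ev_seq _ find_deficit) ev_if.
have fr1 := frame_ev n seed s.
have [q0] := @seed_ok n G (arr s aCur) tg (arr s aPi) (mat n (arr s aX)) s erefl eT.
set s1 := ev n seed s in fr1 * => -[qu1 lk1 mk1 ex1].
have lay1 := layout_frame (fr1.2 aRow isT) (fr1.2 aIn isT) lay.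
have fr2 := frame_ev n scan s1.
have [||r] := @scan_ok n G (arr s aCur) tg (arr s aPi) (mat n (arr s aX))
  s1 q0 lay1 _ _ qu1 lk1 mk1.
- by rewrite (fr1.2 aPi isT).
- by rewrite (fr1.2 aX isT).
set q := q0 ++ r; set s2 := ev n scan s1 in fr2 * => -[_ lk2 mk2 cl2].
have eT2 : arr s2 aTg = tg by rewrite (fr2.2 aTg isT) (fr1.2 aTg isT).
have eC2 : arr s2 aCur = arr s aCur by rewrite (fr2.2 aCur isT) (fr1.2 aCur isT).
have eP2 : arr s2 aPi = arr s aPi by rewrite (fr2.2 aPi isT) (fr1.2 aPi isT).
have eX2 : arr s2 aX = arr s aX by rewrite (fr2.2 aX isT) (fr1.2 aX isT).
have lay2 := layout_frame (fr2.2 aRow isT) (fr2.2 aIn isT) lay1.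
have fr3 := frame_ev n find_deficit s2; have := find_deficit_ok eT2.
set s3 := ev n find_deficit s2 in fr3 * => /= found;
have eT3 : arr s3 aTg = tg by rewrite (fr3.2 aTg isT).
have eC3 : arr s3 aCur = arr s aCur by rewrite (fr3.2 aCur isT).
have eP3 : arr s3 aPi = arr s aPi by rewrite (fr3.2 aPi isT).
have eX3 : arr s3 aX = arr s aX by rewrite (fr3.2 aX isT).
have ePar3 : arr s3 aPar = arr s2 aPar by rewrite (fr3.2 aPar isT).
have lay3 := layout_frame (fr3.2 aRow isT) (fr3.2 aIn isT) lay2.
case: found => [[t0 no_def]|[lt_t t_gt0 t_q def_t]].
  rewrite t0 eqxx; left; have fr4 := frame_ev n raise_unreached s3.
  have piE := raise_unreached_ok s3.
  set s4 := ev n raise_unreached s3 in fr4 piE *.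
  have eC4 : arr s4 aCur = arr s aCur by rewrite (fr4.2 aCur isT).
  split; last by rewrite /excess_count eC4.
  split; [exact: layout_frame (fr4.2 aRow isT) (fr4.2 aIn isT) lay3| |].
    by rewrite (fr4.2 aTg isT).
  rewrite eC4 (fr4.2 aX isT) eX3.
  apply: (primal_dual_lift (R := mem q)) pd _ _ _ _ => /=.
  - by move=> v lt_v ev; rewrite mem_cat ex1.
  - by move=> v lt_v v_q; rewrite -eC2 no_def // mk2.
  - by move=> u v lt_u lt_v u_q adm; exact: cl2 adm.
  by move=> v lt_v; rewrite piE lt_v eP3 ePar3 -[_ == 0]negbK mk2.
rewrite (negbTE t_gt0); right.
set t := (reg s3 rT).-1 in lt_t t_q def_t.
have eT' : reg s3 rT = t.+1 by rewrite /t prednK // lt0n.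
have fr4 := frame_ev n augment s3.
have [|||||r' []] := @augment_ok s3 q t lay3; rewrite ?ePar3 ?eC3 ?eP3 ?eX3 //.
- by rewrite -mk2.
- exact: pd_tight pd.
- exact: pd_bal pd.
set s4 := ev n augment s3 in fr4 * => lt_r ex_r tx' bal' curE.
rewrite eC2 in def_t.
have [pd' count] := primal_dual_augment tg_le1 pd lt_r lt_t ex_r def_t tx' bal' curE.
split=> //; split; [exact: layout_frame (fr4.2 aRow isT) (fr4.2 aIn isT) lay3| |].
  by rewrite (fr4.2 aTg isT).
by rewrite (fr4.2 aPi isT) eP3.
Qed.

Definition optimize := Twice rI improve.

(** Raises and augmentations together number 2n, and at most n are augmentations. The upper bound on
    D later limits the length of every path along which pi rises. *)
Lemma optimize_ok s : flow_state 0 s -> let s' := ev n optimize s in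
  exists2 D, n <= D <= n + n & flow_state D s'.
Proof.
move=> fl0; pose I i s' := exists2 D, D <= i /\ i + excess_count s' <= D + n &
  flow_state D s'.
have [D [le_D]] : I (n + n) (ev n optimize s).
  apply: twice_rule => //.
    exists 0 => //; split=> //; rewrite !add0n /excess_count.
    apply: (@leq_trans (\sum_(v < n) 1)); last by rewrite sum1_card card_ord.
    by apply: leq_sum => v _; exact: leq_b1.
  move=> i s' lt_i _ [D [le_D le_i] /improve_ok[[fl E]|[fl E]]].
    by exists D.+1 => //; split; lia.
  by exists D => //; split; lia.
by move=> le_n fl; exists D => //; lia.
Qed.

End Improve.

(** * Decomposition of the flow into swaps *)

Definition find_arc :=
  rW ::= Cst 0 ;;
  For rV (If (Get aX (entry (Var rU) (Var rV))) (rW ::= Var rV [+] Cst 1) Skip).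

Definition path_prev := Get aPath (Var rTop [-] Cst 1).
Definition path_end := Get aPath (Var rTop).

(** Only the end of the path is free, so the swaps are made from the last arc to the first and the
    free place travels back to the start. *)
Definition unwind_step :=
  If (Var rTop)
    (Put aConf path_prev (Cst 0) ;;
     Put aConf path_end (Cst 1) ;;
     Put aOut (Cst 2 [+] (Var rLen [+] Var rLen)) path_prev ;;
     Put aOut (Cst 3 [+] (Var rLen [+] Var rLen)) path_end ;;
     rLen ::= Var rLen [+] Cst 1 ;;
     rTop ::= Var rTop [-] Cst 1)
    Skip.

Definition unwind := Twice rV unwind_step.

Definition restart :=
  Put aPath (Cst 0) (Var rW) ;;
  rTop ::= Cst 0 ;;
  If (Get aTg (Var rW)) (rAct ::= Cst 0) Skip.

Definition extend :=
  rW ::= Var rW [-] Cst 1 ;;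
  Put aX (entry (Var rU) (Var rW)) (Get aX (entry (Var rU) (Var rW)) [-] Cst 1) ;;
  rTop ::= Var rTop [+] Cst 1 ;;
  Put aPath (Var rTop) (Var rW).

(** The path grows through occupied vertices until a free one allows its tokens to be shifted. The
    walk goes on from there as a new path, or ends if the target wants a token at that vertex. *)
Definition walk_step :=
  If (Var rAct)
    (rU ::= Get aPath (Var rTop) ;;
     find_arc ;;
     extend ;;
     If (Get aConf (Var rW)) Skip (unwind ;; restart))
    Skip.

Definition construct :=
  rLen ::= Cst 0 ;;
  For rI
    (If (Get aConf (Var rI) [-] Get aTg (Var rI))
       (Put aPath (Cst 0) (Var rI) ;;
        rTop ::= Cst 0 ;;
        rAct ::= Cst 1 ;;
        Twice rH walk_step)
       Skip).

Section Construct.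

Variables (n : nat) (G : nat -> nat -> bool) (tg c0 pi : nat -> nat).

Hypothesis pi_bound : forall v, v < n -> pi v <= n + n.
Hypothesis tg_le1 : forall v, v < n -> tg v <= 1.

Definition moved (f : nat -> nat) a b v := if v == b then 1 else if v == a then 0 else f v.

Definition legal (f : nat -> nat) a b :=
  [/\ [/\ a < n, b < n & G a b], pi b = (pi a).+1, f a = 1 & f b = 0].

Fixpoint moves f (L : seq (nat * nat)) g : Prop :=
  if L is p :: L' then legal f p.1 p.2 /\ moves (moved f p.1 p.2) L' g
  else forall v, v < n -> f v = g v.

Lemma moves_rcons f L g g' a b : moves f L g -> legal g a b ->
  (forall v, v < n -> g' v = moved g a b v) -> moves f (rcons L (a, b)) g'.
Proof.
elim: L f => [|p L IH] f /=; last by move=> [lp mL] lg g'E; split=> //; exact: IH lg g'E.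
move=> fg [[lt_a lt_b Gab] pib ga gb] g'E.
split; first by split; rewrite ?fg.
by move=> v lt_v; rewrite g'E // /moved fg.
Qed.

Definition logged s (L : seq (nat * nat)) :=
  reg s rLen = size L /\ forall j, j < size L ->
    arr s aOut (2 + 2 * j) = (nth (0, 0) L j).1 /\
    arr s aOut (3 + 2 * j) = (nth (0, 0) L j).2.

Lemma logged_rcons s s' L a b : logged s L -> reg s' rLen = (size L).+1 ->
  arr s' aOut = upd (upd (arr s aOut) (2 + (size L + size L)) a)
                    (3 + (size L + size L)) b ->
  logged s' (rcons L (a, b)).
Proof.
move=> [_ hL] eL eO; split; first by rewrite size_rcons.
move=> j; rewrite size_rcons ltnS leq_eqVlt nth_rcons => /predU1P[->|lt_j].
  rewrite ltnn eqxx eO mul2n -addnn upd_eq upd_neq; last by lia.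
  by rewrite upd_eq.
rewrite lt_j eO !upd_neq; try lia.
exact: hL.
Qed.

Definition path_to (p : nat -> nat) h :=
  (forall k, k <= h -> p k < n) /\
  (forall k, k < h -> G (p k) (p k.+1) /\ pi (p k.+1) = (pi (p k)).+1).

Lemma path_pi p h k : path_to p h -> k <= h -> pi (p k) = pi (p 0) + k.
Proof.
move=> [_ arc]; elim: k => [|k IH] le_k; first by rewrite addn0.
by rewrite (arc k le_k).2 IH ?addnS // ltnW.
Qed.

Lemma path_neq p h k k' : path_to p h -> k <= h -> k' <= h -> k != k' -> p k != p k'.
Proof.
move=> pp le_k le_k'; apply: contraNneq => /(congr1 pi).
by rewrite (path_pi pp le_k) (path_pi pp le_k') => /addnI->.
Qed.

Lemma unwind_ok s L h : let p := arr s aPath in let f := arr s aConf in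
  logged s L -> moves c0 L f -> reg s rTop = h.+1 -> path_to p h.+1 ->
  (forall k, k <= h -> f (p k) = 1) -> f (p h.+1) = 0 ->
  let s' := ev n unwind s in
  exists2 L', logged s' L' /\ moves c0 L' (arr s' aConf) &
    forall v, arr s' aConf v = moved f (p 0) (p h.+1) v.
Proof.
move=> p f lg mv top pp fp fp_last /=.
(* The configuration once the free place has moved back to p k: [hole h.+1] is f and [hole 0] is the
   final one. *)
pose hole k v := if v == p k then 0 else if v == p h.+1 then 1 else f v.
pose I i s' := exists2 L', logged s' L' /\ moves c0 L' (arr s' aConf) &
  reg s' rTop = h.+1 - i /\ forall v, arr s' aConf v = hole (h.+1 - i) v.
have [L' [lg' mv'] [_ confE]] : I (n + n) (ev n unwind s).
  apply: twice_rule => //.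
    exists L => //; split; rewrite ?subn0 // => v; rewrite /hole.
    by case: (v =P p h.+1) => [->|].
  move=> i s1 lt_i fr [L1 [lg1 mv1] [top1 conf1]].
  have eP := fr.2 aPath isT.
  rewrite /unwind_step ev_if [eval _ _ _]/= top1.
  case: eqP => [top0|/eqP]; first by rewrite ev_skip; exists L1 => //; split;
    [rewrite top1; lia|move=> v; rewrite conf1; congr (hole _ v); lia].
  rewrite -lt0n subn_gt0 ltnS => le_i; rewrite /path_prev /path_end !evE /= !top1 !eP -/p.
  have ei : h.+1 - i = (h - i).+1 by rewrite subSn.
  have ej : h.+1 - i - 1 = h - i by lia.
  rewrite ej ei; set k := h - i in ei ej *.
  have le_k : k <= h by rewrite leq_subr.
  have ne_k : p k != p k.+1 by rewrite (path_neq pp) //; lia.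
  have ne_kh : p k != p h.+1 by rewrite (path_neq pp) //; lia.
  have [len1 _] := lg1; have [lt_p arc] := pp.
  have leg : legal (arr s1 aConf) (p k) (p k.+1).
    have [Gk pik] := arc k le_k.
    split=> //; first by split=> //; apply: lt_p => //; lia.
      by rewrite conf1 /hole ei (negbTE ne_k) (negbTE ne_kh) fp.
    by rewrite conf1 /hole ei eqxx.
  exists (rcons L1 (p k, p k.+1)); first split.
  - by apply: logged_rcons lg1 _ _ => /=; rewrite len1 ?addn1.
  - by apply: moves_rcons mv1 leg _ => v _ /=.
  split=> /=; first by rewrite /k; lia.
  move=> v; rewrite subSS -/k /upd conf1 ei /hole.
  case: (v =P p k.+1) => [->|_].
    rewrite eq_sym (negbTE ne_k); case: eqP => // /eqP ne_v.
    move: le_k; rewrite leq_eqVlt => /predU1P[ek|lt_k]; last by rewrite fp.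
    by rewrite ek eqxx in ne_v.
  by case: (v =P p k).
exists L' => // v; rewrite confE /hole /moved.
(* pi rises by one on each arc and is at most 2n, so 2n iterations undo the whole path. *)
have -> : h.+1 - (n + n) = 0.
  have := path_pi pp (leqnn _); have := pi_bound (pp.1 h.+1 (leqnn _)); lia.
case: (v =P p 0) => [->|_]; last by [].
by rewrite (negbTE (path_neq pp _ _ _)).
Qed.

Lemma find_arc_ok s : layout n G s -> reg s rU < n ->
  0 < outflow n (mat n (arr s aX)) (reg s rU) ->
  exists w, [/\ w < n, reg (ev n find_arc s) rW = w.+1 &
                0 < mat n (arr s aX) (reg s rU) w].
Proof.
move=> [row _] lt_u out_gt0; rewrite /find_arc; set c := If _ _ _; rewrite !evE /=.
set u := reg s rU in lt_u out_gt0 *.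
pose I i s' := (reg s' rW = 0 /\ forall v, v < i -> mat n (arr s aX) u v = 0) \/
  exists w, [/\ w < n, reg s' rW = w.+1 & 0 < mat n (arr s aX) u w].
have [||s' [-> fr [[_ none]|//]]] := @for_rule I n rV c (set_reg s rW 0).
- by left.
- move=> i s1 lt_i fr Ii; rewrite /c /entry !evE /= (fr.2 aRow isT) (fr.2 aX isT).
  rewrite (fr.1 rU isT) /= row // -/u; case: eqP => [x0|/eqP].
    case: Ii => [[w0 Ii]|]; [left|by right].
    by split=> // v; rewrite ltnS leq_eqVlt => /predU1P[->|]; [exact: x0|exact: Ii].
  by rewrite -lt0n => x_gt0; right; exists i; rewrite /= addn1.
by move: out_gt0; rewrite /outflow big1 // => v _; exact: none.
Qed.

(* During an active walk the arcs of the path p 0, ..., p h have already been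
   removed from the flow, whereas the token of p 0 has not moved yet. *)
Definition conserved (i0 i : nat) s :=
  [/\ exists2 L, logged s L & moves c0 L (arr s aConf),
      forall v, v < n -> arr s aConf v <= 1,
      tight n G pi (mat n (arr s aX)) &
  let p := arr s aPath in let h := reg s rTop in
  let f := arr s aConf in let x := mat n (arr s aX) in
  if reg s rAct == 0 then
    balanced n x f tg /\ forall v, v < i0 -> ~~ excess tg f v
  else
    [/\ path_to p h, forall k, k <= h -> f (p k) = 1, tg (p 0) = 0 /\ i <= pi (p h),
      balanced n x (plus1 f (p h)) (plus1 tg (p 0)) &
      forall v, v < i0 -> excess tg f v -> v = p 0]].

Lemma walk_step_ok i0 i s : layout n G s -> arr s aTg = tg ->
  conserved i0 i s -> conserved i0 i.+1 (ev n walk_step s).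
Proof.
move=> lay eT cons; have [[L lg mv] f_le1 tx] := cons.
rewrite /walk_step ev_if [eval _ _ _]/=; case: eqP => [act0|/eqP act] /=.
  by move=> rest; rewrite ev_skip; split=> //; [exists L|rewrite act0].
set p := arr s aPath; set h := reg s rTop; set f := arr s aConf.
move=> [pp fp [tg0 le_i] bal exc_le].
have lt_u : p h < n by exact: pp.1.
(* At the tip the supply, pending unit included, is 2, while the demand is at most 1: the pending
   demand sits at p 0, where tg is 0. Some flow must leave. *)
have out_gt0 : 0 < outflow n (mat n (arr s aX)) (p h).
  have := bal (p h) lt_u; rewrite /plus1 eqxx fp //.
  by case: eqP => [->|_]; rewrite ?tg0 //=; have := tg_le1 lt_u; lia.
rewrite (ev_seq _ (_ ::= _)) ev_asg (ev_seq _ find_arc) (ev_seq _ extend).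
set s1 := set_reg s rU _.
have [w [lt_w eW x_gt0]] := @find_arc_ok s1 lay lt_u out_gt0.
have fr2 := frame_ev n find_arc s1; set s2 := ev n find_arc s1 in fr2 eW *.
have {}x_gt0 : 0 < arr s aX (p h * n + w) := x_gt0.
have [row _] := lay.
have := frame_ev n extend s2; set s3 := ev n extend s2 => fr3.
have [X3 top3 path3 w3] : [/\ arr s3 aX = upd (arr s aX) (p h * n + w)
      (arr s aX (p h * n + w) - 1), reg s3 rTop = h.+1,
    arr s3 aPath = upd p h.+1 w & reg s3 rW = w].
  rewrite /s3 /extend /entry !evE /= eW subn1 /= (fr2.2 aX isT) (fr2.2 aRow isT).
  rewrite (fr2.2 aPath isT) (fr2.1 rU isT) (fr2.1 rTop isT) /= row // -/h.
  by rewrite addn1.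
have conf3 : arr s3 aConf = f by rewrite (fr3.2 aConf isT) (fr2.2 aConf isT).
have tg3 : arr s3 aTg = tg by rewrite (fr3.2 aTg isT) (fr2.2 aTg isT).
have act3 : reg s3 rAct != 0 by rewrite (fr3.1 rAct isT) (fr2.1 rAct isT).
have lg3 : logged s3 L.
  rewrite /logged (fr3.1 rLen isT) (fr3.2 aOut isT).
  by rewrite (fr2.1 rLen isT) (fr2.2 aOut isT).
have dec := decrement_upd lt_u lt_w x_gt0.
have tx3 := tight_decrement dec tx.
have bal3 := (balanced_increment _ _ lt_u lt_w dec).2 bal.
rewrite -X3 in tx3 bal3.
have [Guw piw] := tx _ _ lt_u lt_w x_gt0.
have p3E k : k <= h -> arr s3 aPath k = p k.
  by move=> le_k; rewrite path3 upd_neq //; lia.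
have p3w : arr s3 aPath h.+1 = w by rewrite path3 upd_eq.
have pp3 : path_to (arr s3 aPath) h.+1.
  split=> k; rewrite leq_eqVlt => /predU1P[].
  - by move->; rewrite p3w.
  - by move=> lt_k; rewrite p3E //; exact: pp.1.
  - by case=> ->; rewrite p3w p3E.
  by move=> lt_k; rewrite !p3E //; [exact: pp.2|exact: ltnW].
rewrite ev_if [eval _ _ _]/= conf3 w3; case: eqP => [fw|/eqP fw]; last first.
  have fw1 : f w = 1 by have := f_le1 w lt_w; rewrite -/f; lia.
  rewrite ev_skip; split; rewrite ?conf3 //; first by exists L.
  rewrite (negbTE act3) top3; split=> //.
  - by move=> k; rewrite leq_eqVlt => /predU1P[->|lt_k]; rewrite ?p3w // p3E // fp.
  - by rewrite p3E // p3w piw; split=> //; lia.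
  - by rewrite p3w p3E.
  by rewrite p3E.
rewrite ev_seq.
have [|||L4 [lg4 mv4] conf4] := @unwind_ok s3 L h lg3 _ top3 pp3; rewrite ?conf3 //.
- by move=> k le_k; rewrite p3E // fp.
- by rewrite p3w.
have fr4 := frame_ev n unwind s3; set s4 := ev n unwind s3 in fr4 lg4 mv4 conf4 *.
have ne_w0 : w != p 0.
  by have := path_neq pp3 (leqnn h.+1) (leq0n _) isT; rewrite p3w p3E.
rewrite conf3 p3E // p3w in conf4.
have f0 := fp 0 (leq0n h).
have conf4_le v : v < n -> arr s4 aConf v <= 1.
  move=> lt_v; rewrite conf4 /moved; case: eqP => // _; case: eqP => // _.
  exact: f_le1.
have exc4 v : v < i0 -> excess tg (arr s4 aConf) v -> v = w /\ tg w = 0.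
  move=> lt_v; rewrite /excess conf4 /moved.
  case: (v =P w) => [->|_]; first by rewrite ltnS leqn0 => /eqP.
  by case: (v =P p 0) => // ne_v0 /(exc_le v lt_v).
rewrite /restart !evE /= (fr4.2 aTg isT) tg3 (fr4.1 rW isT) w3.
case: eqP => [tw0|/eqP tw0]; rewrite ?ev_skip ?ev_asg; split=> //=.
- by exists L4.
- by rewrite (fr4.2 aX isT).
- rewrite (fr4.1 rAct isT) (negbTE act3); split=> //.
  + by split=> // k; rewrite leqn0 => /eqP->; rewrite upd_eq.
  + by move=> k; rewrite leqn0 => /eqP->; rewrite upd_eq conf4 /moved eqxx.
  + by rewrite upd_eq piw; split=> //; lia.
  + rewrite upd_eq (fr4.2 aX isT); apply: eq_balanced bal3 => v lt_v.
    rewrite /plus1 conf4 /moved; move: ne_w0 f0 fw.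
    case: (v =P w) => [->|_]; first by move=> /negbTE-> _ ->; lia.
    by case: (v =P p 0) => [->|_] _ f0 _; rewrite ?f0; lia.
  + by move=> v lt_v /exc4[] // ->; rewrite upd_eq.
- by exists L4.
- by rewrite (fr4.2 aX isT).
split; last first.
  move=> v lt_v; apply/negP => /exc4[] // _ tw; by rewrite tw in tw0.
rewrite (fr4.2 aX isT); apply: eq_balanced bal3 => v lt_v.
have tw1 : tg w = 1 by have := tg_le1 lt_w; lia.
rewrite /plus1 conf4 /moved; move: ne_w0 f0 fw.
case: (v =P w) => [->|_]; first by move=> /negbTE-> _ ->; lia.
by case: (v =P p 0) => [->|_] _ f0 _; rewrite ?f0; lia.
Qed.

(** A walk ends only at a vertex with target 1, so it creates no excess and the vertices treated
    earlier stay settled. *)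
Lemma construct_ok s : layout n G s -> arr s aTg = tg -> arr s aConf = c0 ->
  (forall v, v < n -> c0 v <= 1) -> tight n G pi (mat n (arr s aX)) ->
  balanced n (mat n (arr s aX)) c0 tg ->
  let s' := ev n construct s in exists2 L, logged s' L & moves c0 L tg.
Proof.
move=> lay eT eF c0_le1 tx bal; rewrite /construct; set c := If _ _ _.
rewrite ev_seq ev_asg; set s0 := set_reg s rLen _.
pose I i s' := [/\ exists2 L, logged s' L & moves c0 L (arr s' aConf),
  forall v, v < n -> arr s' aConf v <= 1, tight n G pi (mat n (arr s' aX)),
  balanced n (mat n (arr s' aX)) (arr s' aConf) tg
  & forall v, v < i -> ~~ excess tg (arr s' aConf) v].
have [||s' [-> fr [[L lg mv] _ tx' bal' no_exc]]] := @for_rule I n rI c s0.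
- by split; rewrite /= ?eF //; exists [::].
- move=> i s1 lt_i fr [[L lg mv] f_le1 tx1 bal1 no_exc].
  have eT1 : arr s1 aTg = tg by rewrite (fr.2 aTg isT).
  rewrite /c ev_if [eval _ _ _]/= eT1; case: eqP => [le_i|/eqP gt_i].
    rewrite ev_skip; split=> //=; first by exists L.
    move=> v; rewrite ltnS leq_eqVlt => /predU1P[->|]; last exact: no_exc.
    by rewrite /excess; lia.
  rewrite (ev_seq _ (Put _ _ _)) !(ev_seq _ (_ ::= _)) !ev_asg ev_put.
  set s2 := set_reg (set_reg _ _ _) _ _.
  have lay2 : layout n G s2 by exact: layout_frame (fr.2 aRow isT) (fr.2 aIn isT) lay.
  have cons2 : conserved i.+1 0 s2.
    split; rewrite /s2 /= ?upd_eq //; first by exists L.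
    have [fi tgi] : arr s1 aConf i = 1 /\ tg i = 0 by have := f_le1 i lt_i; lia.
    split=> //.
    + by split=> // k; rewrite leqn0 => /eqP->; rewrite upd_eq.
    + by move=> k; rewrite leqn0 => /eqP->; rewrite upd_eq.
    + by apply: eq_balanced bal1 => v _; rewrite /plus1; lia.
    move=> v; rewrite ltnS leq_eqVlt => /predU1P[-> //|lt_v].
    by rewrite (negbTE (no_exc v lt_v)).
  have : conserved i.+1 (n + n) (ev n (Twice rH walk_step) s2).
    apply: twice_rule cons2 _ => // j s3 lt_j fr3.
    apply: walk_step_ok; last by rewrite (fr3.2 aTg isT).
    exact: layout_frame (fr3.2 aRow isT) (fr3.2 aIn isT) lay2.
  set s3 := ev n _ s2 => -[h1 f3 tx3]; cbv zeta; case: ifP => [_ [bal3 exc3]|_].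
    by split.
  (* A walk still active after 2n steps has a tip of potential at least 2n, and by conservation an
     arc leads on to a vertex violating the bound on pi. *)
  move=> [pp fp [tg0 le_pi] bal3 _]; set u := arr s3 aPath _ in le_pi bal3.
  have lt_u : u < n by exact: pp.1.
  have : 0 < outflow n (mat n (arr s3 aX)) u.
    have := bal3 u lt_u; rewrite /plus1 eqxx fp //.
    by case: eqP => [->|_]; rewrite ?tg0 //=; have := tg_le1 lt_u; lia.
  rewrite lt0n sum_nat_eq0 => /forallPn[/= v]; rewrite -lt0n => x_gt0.
  have [_ piv] := tx3 u v lt_u (ltn_ord v) x_gt0.
  by have := pi_bound (ltn_ord v); rewrite piv; lia.
exists L => //; have eq_f := balanced_no_excess tx' bal' no_exc.
elim: L c0 mv {lg} => [|p L IH] f /=; first by move=> e v lt_v; rewrite e ?eq_f.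
by case=> lp /IH.
Qed.

End Construct.

(** * The whole algorithm and its input and output *)

Notation rL := 1 (only parsing).
Notation rCode := 2 (only parsing).
Notation rEnd := 18 (only parsing).
Notation rAns := 19 (only parsing).
Notation rCount := 21 (only parsing).

(** Recovers the three bits from 4a + 2b + c, truncated differences serving as comparisons. *)
Definition decode :=
  Put aIn (Cst 2) (Cst 0) ;;
  If (Var rCode [-] Cst 3)
    (Put aIn (Cst 3) (Cst 1) ;; rCode ::= Var rCode [-] Cst 4)
    (Put aIn (Cst 3) (Cst 0)) ;;
  If (Var rCode [-] Cst 1)
    (Put aIn (Cst 4) (Cst 1) ;; rCode ::= Var rCode [-] Cst 2)
    (Put aIn (Cst 4) (Cst 0)) ;;
  Put aIn (Cst 5) (Var rCode).

Definition fill_rows :=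
  rAcc ::= Cst 0 ;;
  For rI (Put aRow (Var rI) (Var rAcc) ;; rAcc ::= Var rAcc [+] Size).

(** Colors 1 and 2 become 1 and 0. [rAcc] still holds n * n from [fill_rows]. *)
Definition color_in := Cst 2 [-] Get aIn (Cst 2 [+] Var rAcc [+] Var rI).
Definition color_out := Cst 2 [-] Get aIn (Cst 2 [+] Var rAcc [+] Size [+] Var rI).

(** Every array is initialised explicitly because its cells may still contain parts of the original
    input. *)
Definition fill_state :=
  For rI
    (Put aCur (Var rI) color_in ;;
     Put aConf (Var rI) color_in ;;
     Put aTg (Var rI) color_out ;;
     Put aPi (Var rI) (Cst 0) ;;
     For rV (Put aX (entry (Var rI) (Var rV)) (Cst 0))).

Definition setup := decode ;; fill_rows ;; fill_state.

Definition check :=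
  rOk ::= Cst 1 ;;
  For rV (If (neq (Get aCur (Var rV)) (Get aTg (Var rV))) (rOk ::= Cst 0) Skip).

Definition solve := setup ;; optimize ;; check ;; If (Var rOk) construct Skip.

Definition verdict :=
  rAns ::= Cst 0 ;;
  If (Var rOk) (If (Var rLen [-] Var rL) Skip (rAns ::= Cst 1)) Skip.

Fixpoint copy_low k :=
  if k is k'.+1 then
    copy_low k' ;; Put aOut (Var rEnd [+] Cst k') (Get aOut (Cst k'))
  else Skip.

(* Entries 0 to 5 are duplicated past the end of the output, because the
   epilogue needs cells 0 to 5 as registers until its last instructions. *)
Definition emit :=
  If (Var rOk) Skip (rLen ::= Cst 0) ;;
  Put aOut (Cst 0) (Var rOk) ;;
  Put aOut (Cst 1) (Var rLen) ;;
  rCount ::= Cst 2 [+] Var rLen [+] Var rLen [-] Cst 6 ;;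
  rEnd ::= Cst 6 [+] Var rCount ;;
  copy_low 6.

Lemma moves_ext n G pi f f' g g' L : (forall v, v < n -> f v = f' v) ->
  (forall v, v < n -> g v = g' v) -> moves n G pi f L g -> moves n G pi f' L g'.
Proof.
move=> ff' gg'; elim: L f f' ff' => [|p L IH] f f' ff' /=.
  by move=> fg v lt_v; rewrite -ff' // fg // gg'.
case=> [[[lt_a lt_b Gab] pib fa fb]] mv; split; first by split; rewrite -?ff'.
by apply: IH mv => v lt_v; rewrite /moved ff'.
Qed.

Section Solve.

Variables (n : nat) (G : nat -> nat -> bool) (inp : nat -> nat).

Hypothesis n_gt1 : 1 < n.
Hypothesis symG : symmetric G.
Hypothesis inp_G : forall u v, u < n -> v < n -> inp (2 + u * n + v) = G u v.
Hypothesis inp_diag : inp 2 = 0.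

Let src v := 2 - inp (2 + n * n + v).
Let dst v := 2 - inp (2 + n * n + n + v).

Hypothesis src_le1 : forall v, v < n -> src v <= 1.
Hypothesis dst_le1 : forall v, v < n -> dst v <= 1.

Definition loaded s :=
  reg s rCode = 4 * inp 3 + 2 * inp 4 + inp 5 /\
  forall i, 6 <= i < 2 + n * n + n + n -> arr s aIn i = inp i.

Lemma decode_ok s : inp 3 <= 1 -> inp 4 <= 1 -> inp 5 <= 1 -> loaded s ->
  forall i, 2 <= i < 2 + n * n + n + n -> arr (ev n decode s) aIn i = inp i.
Proof.
move=> b3 b4 b5 [code inE] i /andP[le_2i lt_i].
have inE' : 6 <= i -> arr s aIn i = inp i by move=> le_6i; rewrite inE // le_6i.
rewrite /decode !ev_seq !ev_put (ev_if _ (Var rCode [-] Cst 3)) /= code.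
have E : [|| i == 2, i == 3, i == 4, i == 5 | 6 <= i] by lia.
case: eqP => [c3|/eqP c3]; rewrite !evE /= code;
  (case: eqP => [c4|/eqP c4]; rewrite /= ?code /upd);
  case/or4P: E => [/eqP->|/eqP->|/eqP->|/orP[/eqP->|le_6i]] /=;
  rewrite ?gtn_eqF ?inE' //; lia.
Qed.

Lemma fill_rows_ok s : let s' := ev n fill_rows s in
  reg s' rAcc = n * n /\ forall i, i < n -> arr s' aRow i = i * n.
Proof.
rewrite /fill_rows; set c := Seq (Put _ _ _) _; rewrite !evE /=.
pose I i s' := reg s' rAcc = i * n /\ forall j, j < i -> arr s' aRow j = j * n.
have [||s' [-> fr In]] := @for_rule I n rI c (set_reg s rAcc 0); last exact: In.
  by [].
move=> i s1 lt_i fr [acc row]; rewrite /c !evE; split=> /=.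
  by rewrite acc mulSn addnC.
move=> j; rewrite ltnS leq_eqVlt /upd => /predU1P[->|lt_j]; first by rewrite eqxx.
by rewrite ltn_eqF // row.
Qed.

Lemma fill_state_ok s : reg s rAcc = n * n ->
  (forall i, i < n -> arr s aRow i = i * n) ->
  (forall i, 2 <= i < 2 + n * n + n + n -> arr s aIn i = inp i) ->
  let s' := ev n fill_state s in forall v, v < n ->
  [/\ arr s' aCur v = src v, arr s' aConf v = src v, arr s' aTg v = dst v,
      arr s' aPi v = 0 & forall u, u < n -> mat n (arr s' aX) v u = 0].
Proof.
move=> acc row inE; rewrite /fill_state; set cv := For rV _; set c := Seq _ _.
pose I i s' := forall v, v < i ->
  [/\ arr s' aCur v = src v, arr s' aConf v = src v, arr s' aTg v = dst v,
      arr s' aPi v = 0 & forall u, u < n -> mat n (arr s' aX) v u = 0].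
have [||s' [-> fr In]] := @for_rule I n rI c s; [by []| |exact: In].
move=> i s1 lt_i fr Ii; rewrite /c !evE.
set s2 := set_arr _ aPi _ _.
pose J j s' := (forall u, u < j -> mat n (arr s' aX) i u = 0) /\
  forall v u, v < i -> u < n -> mat n (arr s' aX) v u = 0.
have row2 k : k < n -> arr s2 aRow k = k * n.
  by move=> lt_k; rewrite /s2 /= (fr.2 aRow isT) row.
have [||s3 [-> fr3 [J1 J2]]] := @for_rule J n rV (Put aX (entry (Var rI) (Var rV)) (Cst 0)) s2.
- by split=> // v u lt_v lt_u; case: (Ii v lt_v) => _ _ _ _; exact.
- move=> j s3 lt_j fr3 [J1 J2]; rewrite !evE /J /= (fr3.2 aRow isT) (fr3.1 rI isT).
  rewrite row2 //; split=> [u|v u lt_v lt_u].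
    rewrite ltnS leq_eqVlt => /predU1P[->|lt_u]; rewrite mat_upd ?eqxx //.
      by case: ifP => // _; exact: J1.
    exact: ltn_trans lt_j.
  by rewrite mat_upd // (ltn_eqF lt_v) J2.
have inE1 k : 2 <= k < 2 + n * n + n + n -> arr s1 aIn k = inp k.
  by move=> lt_k; rewrite (fr.2 aIn isT) inE.
have acc1 : reg s1 rAcc = n * n by rewrite (fr.1 rAcc isT).
move=> v; rewrite ltnS leq_eqVlt => /predU1P[->|lt_v] /=.
  rewrite (fr3.2 aCur isT) (fr3.2 aConf isT) (fr3.2 aTg isT) (fr3.2 aPi isT) /s2 /=.
  by rewrite !upd_eq acc1 !inE1 //; lia.
rewrite (fr3.2 aCur isT) (fr3.2 aConf isT) (fr3.2 aTg isT) (fr3.2 aPi isT) /s2 /=.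
have [h1 h2 h3 h4 h5] := Ii v lt_v.
by rewrite !upd_neq ?ltn_eqF //; split=> // u; exact: J2.
Qed.

Lemma setup_ok s : inp 3 <= 1 -> inp 4 <= 1 -> inp 5 <= 1 -> loaded s ->
  let s' := ev n setup s in let tg := arr s' aTg in let c0 := arr s' aConf in
  [/\ flow_state n G tg c0 0 s', forall v, v < n -> c0 v = src v
    & forall v, v < n -> tg v = dst v].
Proof.
move=> b3 b4 b5 ld; rewrite /setup (ev_seq _ decode) (ev_seq _ fill_rows) /=.
have := decode_ok b3 b4 b5 ld; set s1 := ev n decode s => in1.
have := fill_rows_ok s1; have := frame_ev n fill_rows s1.
set s2 := ev n fill_rows s1 => fr2 [acc2 row2].
have in2 i : 2 <= i < 2 + n * n + n + n -> arr s2 aIn i = inp i.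
  by rewrite (fr2.2 aIn isT); exact: in1.
have := fill_state_ok acc2 row2 in2; have := frame_ev n fill_state s2.
set s3 := ev n fill_state s2 => fr3 /= st3.
have sum0 (F : nat -> nat) : (forall v, v < n -> F v = 0) -> \sum_(v < n) F v = 0.
  by move=> F0; rewrite big1 // => v _; rewrite F0.
split; try by move=> v /st3[].
split=> //.
  split=> [i lt_i|u v lt_u lt_v]; first by rewrite (fr3.2 aRow isT) row2.
  by rewrite (fr3.2 aIn isT) in2 ?inp_G //; nia.
split.
- by move=> v lt_v; have [-> _ _ _ _] := st3 v lt_v; exact: src_le1.
- by move=> u v lt_u lt_v _; have [_ _ _ -> _] := st3 v lt_v.
- by move=> u v lt_u lt_v; have [_ _ _ _ ->] := st3 u lt_u.
- move=> v lt_v; have [-> -> _ _ x0] := st3 v lt_v.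
  rewrite /inflow /outflow (sum0 (mat n (arr s3 aX) v)) //.
  by rewrite (sum0 (fun u => mat n (arr s3 aX) u v)) // => u /st3[_ _ _ _]; apply.
- by move=> v lt_v; have [_ _ _ -> _] := st3 v lt_v.
- by move=> v lt_v _; have [_ _ _ -> _] := st3 v lt_v.
by move=> v lt_v _; have [_ _ _ -> _] := st3 v lt_v.
Qed.

Lemma check_ok s : reg (ev n check s) rOk =
  [forall v : 'I_n, arr s aCur v == arr s aTg v].
Proof.
rewrite /check; set c := If _ _ _; rewrite !evE /=.
pose I i s' := reg s' rOk =
  [forall v : 'I_n, (v < i) ==> (arr s aCur v == arr s aTg v)] :> nat.
have [||s' [-> fr In]] := @for_rule I n rV c (set_reg s rOk 1).
- by rewrite /I /=; case: forallP => // -[].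
- move=> i s1 lt_i fr Ii; rewrite /c /neq !evE /= (fr.2 aCur isT) (fr.2 aTg isT) /=.
  case: eqP => [e|ne]; rewrite /I /=.
    rewrite Ii; congr nat_of_bool; apply: eq_forallb => v; rewrite ltnS [in RHS]leq_eqVlt.
    by case: (val v =P i) => [->|] //=; rewrite ltnn /=; apply/esym/eqP; lia.
  case: forallP => // /(_ (Ordinal lt_i)) /=; rewrite ltnSn /= => /eqP; lia.
rewrite /= In; congr nat_of_bool; apply: eq_forallb => v; by rewrite ltn_ord.
Qed.

(** Each outcome carries its certificate, a separating weight or a potential, from which
    impossibility or optimality is derived without the machine. *)
Lemma solve_ok s : inp 3 <= 1 -> inp 4 <= 1 -> inp 5 <= 1 -> loaded s ->
  let s' := ev n solve s in
  (reg s' rOk = 0 /\ exists2 w : nat -> nat,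
     forall u v, u < n -> v < n -> G u v -> w u = w v &
     \sum_(v < n) w v * src v != \sum_(v < n) w v * dst v) \/
  (reg s' rOk = 1 /\ exists pi L, [/\ lipschitz n G pi,
     forall v, v < n -> pi v <= n + n, moves n G pi src L dst & logged s' L]).
Proof.
move=> b3 b4 b5 ld; rewrite /solve (ev_seq _ setup) (ev_seq _ optimize) (ev_seq _ check).
have := setup_ok b3 b4 b5 ld; set s1 := ev n setup s; cbv zeta => -[fl1 c0E tgE].
have tg_le1 v : v < n -> arr s1 aTg v <= 1.
  by move=> lt_v; rewrite tgE //; exact: dst_le1.
have := optimize_ok tg_le1 fl1; have := frame_ev n optimize s1.
set s2 := ev n optimize s1 => fr2 /= [D /andP[le_nD le_D] [lay2 eT2 pd2]].
have := check_ok s2; have := frame_ev n check s2.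
set s3 := ev n check s2 => fr3 ok3; rewrite ev_if [eval _ _ _]/=.
have ok4 : reg (if reg s3 rOk == 0 then ev n Skip s3 else ev n construct s3) rOk =
    reg s3 rOk.
  by case: eqP => // _; exact: (frame_ev n construct s3).1.
rewrite ok4 ok3; case matched: [forall v : 'I_n, _]; last first.
  left; rewrite /=; split=> //.
  have [|w inv_w ne] := primal_dual_cut symG pd2 le_nD.
    by rewrite -eT2 matched.
  exists w => //; move: ne; congr (_ != _); apply: eq_bigr => v _.
    by rewrite c0E.
  by rewrite tgE.
right; rewrite /=; split=> //; exists (arr s2 aPi).
have lay3 := layout_frame (fr3.2 aRow isT) (fr3.2 aIn isT) lay2.
have pi_le v : v < n -> arr s2 aPi v <= n + n.
  by move=> lt_v; apply: leq_trans le_D; exact: (pd_bound pd2).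
have eT3 : arr s3 aTg = arr s1 aTg by rewrite (fr3.2 aTg isT).
have eF3 : arr s3 aConf = arr s1 aConf.
  by rewrite (fr3.2 aConf isT) (fr2.2 aConf isT).
have [|||L lg mv] := construct_ok pi_le tg_le1 lay3 eT3 eF3.
- by move=> v lt_v; rewrite c0E //; exact: src_le1.
- by rewrite (fr3.2 aX isT); exact: (pd_tight pd2).
- rewrite (fr3.2 aX isT); apply: eq_balanced (pd_bal pd2) => v lt_v.
  by have /eqP := forallP matched (Ordinal lt_v); rewrite /= eT2 => ->.
exists L; split=> //; first exact: (pd_lip pd2).
by apply: moves_ext mv => v lt_v; [exact: c0E|exact: tgE].
Qed.

End Solve.

(** * Moving the input away and the output into place *)

(* Every cell with a fixed address may hold input.  Cell 2 is G 0 0 = 0 and, as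
   1 < n, cells 3, 4 and 5 are adjacency bits: packing these bits into cell 2
   frees three registers, enough to move each input cell i to [cell aIn i].  The
   moves run downwards so that no source is overwritten. *)
Definition pack_bits : program :=
  [:: IAdd 2 3 3; IAdd 2 2 4; IAdd 2 2 2; IAdd 2 2 5;
      IConst 4 2; IAdd 4 4 0; IAdd 4 4 0; IConst 3 1; IConst 5 0; IAdd 5 5 0].

(** Adds n to cell 4 n times, turning 2 + 2n into the end of the input. *)
Definition square_loop : program :=
  [:: IJz 5 14; IAdd 4 4 0; ISub 5 5 3; IJmp 10].

(** Cell 5 receives 64 + 16 y, the address [cell aIn y]. Cell 3 is left with y - 6 for the loop
    test, entry 6 being the last one moved. *)
Definition move_cell : program :=
  [:: IConst 3 1; ISub 4 4 3; IAdd 5 4 4; IAdd 5 5 5; IAdd 5 5 5; IAdd 5 5 5;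
      IConst 3 64; IAdd 5 5 3] ++
  [:: ILoad 3 4; IStore 5 3; IConst 3 6; ISub 3 4 3].

(** Its 28 instructions determine the exit target 28, which is also the load address of the compiled
    code. *)
Definition prologue : program :=
  pack_bits ++ square_loop ++ move_cell ++ [:: IJz 3 28; IJmp 14].

(** A memory with n in cell 0 simulates the state read off from it, so uninitialised registers and
    arrays may hold anything. *)
Definition state_of m := State m (fun a i => m (cell a i)).

Lemma simulates_state_of n m : m 0 = n -> simulates n m (state_of m).
Proof. by []. Qed.

Lemma move_cell_ok (m : memory) y : m 4 = y.+1 -> 6 <= y ->
  let m' := foldl effect m move_cell in
  [/\ m' 3 = y - 6, m' 4 = y, m' (cell 0 y) = m y &
      forall i, i \notin [:: 3; 4; 5; cell 0 y] -> m' i = m i].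
Proof.
move=> m4 le_6y; rewrite /move_cell foldl_cat; set m1 := foldl _ m _.
have [m14 m15] : m1 4 = y /\ m1 5 = cell 0 y.
  by rewrite /m1 /= /upd /= m4 subn1 /= /cell; split=> //; lia.
have m1E i : i \notin [:: 3; 4; 5] -> m1 i = m i.
  rewrite !inE !negb_or /m1 /= /upd => /and3P[/negbTE i3 /negbTE i4 /negbTE i5].
  by rewrite i3 i4 i5.
have y_fresh : y \notin [:: 3; 4; 5] by rewrite !inE; lia.
rewrite /= {}/m1 in m14 m15 m1E *; move: (foldl _ _ _) m14 m15 m1E => m1 m14 m15 m1E.
have c4 : 4 == cell 0 y = false by rewrite /cell; lia.
rewrite /upd /= m15 c4 m14; split=> //; first by rewrite eqxx (m1E y).
move=> i; rewrite !inE !negb_or => /and4P[i3 i4 i5 /negbTE ic].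
by rewrite (negbTE i3) ic m1E // !inE !negb_or i3 i4 i5.
Qed.

Lemma prologue_ok P n (inp : memory) : code_at P 0 prologue -> 1 < n ->
  inp 0 = n -> exists m,
  [/\ reaches P (18 * n ^ 2 + 40 * n + 50) (0, inp) (28, m), m 0 = n, m 1 = inp 1
    & loaded n inp (state_of m)].
Proof.
move=> at_p n_gt1 inp0.
have [at_1 /code_at_cat[at_2 /code_at_cat[at_3 at_4]]] := code_at_cat at_p.
rewrite /= !add0n in at_2 at_3 at_4.
set code := 4 * inp 3 + 2 * inp 4 + inp 5.
have := reaches_straight inp (isT : all straight pack_bits) at_1.
set m1 := foldl effect inp pack_bits; rewrite /= add0n => r1.
have [m10 m11 m12 m13] : [/\ m1 0 = n, m1 1 = inp 1, m1 2 = code & m1 3 = 1].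
  by rewrite /m1 /= /upd /= inp0; split=> //; rewrite /code; lia.
have [m14 m15 m1i] : [/\ m1 4 = 2 + n + n, m1 5 = n & forall i, 6 <= i -> m1 i = inp i].
  rewrite /m1 /= /upd /= inp0 add0n; split=> // i le_6i.
  by do !rewrite gtn_eqF; rewrite //; lia.
have square : forall k (m : memory), m 5 = k -> m 0 = n -> m 1 = inp 1 -> m 2 = code ->
    m 3 = 1 -> (forall i, 6 <= i -> m i = inp i) ->
    exists m', [/\ reaches P (4 * k + 1) (10, m) (14, m'),
      m' 4 = m 4 + k * n, m' 0 = n, m' 1 = inp 1 &
      m' 2 = code /\ forall i, 6 <= i -> m' i = inp i].
  elim=> [|k IH] m h5 h0 h1 h2 h3 hi.
    exists m; split=> //; last by rewrite addn0.
    by apply: reaches_step; [rewrite /= (at_2 0 isT) /= h5|exact: reaches_refl].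
  set m' := upd (upd m 4 (m 4 + n)) 5 k.
  have [||||||m'' [r4 e4 e0 e1 [e2 ei]]] := IH m'; rewrite /m' /upd //=.
    by move=> i le_6i; rewrite !gtn_eqF ?hi //; lia.
  exists m''; split=> //; last by rewrite e4 /m' /upd /= mulSn addnA.
  have -> : 4 * k.+1 + 1 = (4 * k + 1).+4 by lia.
  apply: reaches_step; first by rewrite /= (at_2 0 isT) /= h5.
  apply: reaches_step; first by rewrite /= (at_2 1 isT).
  apply: reaches_step; first by rewrite /= (at_2 2 isT).
  apply: reaches_step; first by rewrite /= (at_2 3 isT).
  by rewrite h0 (_ : _ - _ = k) // /upd /= h5 h3 subn1.
have [m2 [r2 m24 m20 m21 [m22 m2i]]] := square n m1 m15 m10 m11 m12 m13 m1i.
set top := 2 + n * n + n + n.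
(* Cell 4 points one past the next entry to move, so the value k + 7 leaves k + 1 turns. *)
have move_all : forall k (m : memory), m 4 = k + 7 -> m 0 = n -> m 1 = inp 1 -> m 2 = code ->
    (forall i, 6 <= i < k + 7 -> m i = inp i) ->
    (forall i, k + 7 <= i < top -> m (cell 0 i) = inp i) ->
    exists m', [/\ reaches P (14 * k.+1) (14, m) (28, m'), m' 0 = n, m' 1 = inp 1,
      m' 2 = code & forall i, 6 <= i < top -> m' (cell 0 i) = inp i].
  elim=> [|k IH] m h4 h0 h1 h2 hi ho.
    have := reaches_straight m (isT : all straight move_cell) at_3.
    have [e3 e4 eo ei] := @move_cell_ok m 6 h4 isT.
    set m' := foldl effect m move_cell in e3 e4 eo ei * => r.
    exists m'; split; rewrite ?ei //; last first.
      move=> i /andP[]; rewrite leq_eqVlt => /predU1P[<- _|lt_6i lt_i].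
        by rewrite eo; apply: hi.
      by rewrite ei; [apply: ho; lia|rewrite !inE /cell; lia].
    rewrite (_ : 14 * 1 = 12 + 2) //; apply: reaches_trans r _.
    apply: reaches_step; first by rewrite /= (at_4 0 isT) /= e3.
    exact: reaches_refl.
  have := reaches_straight m (isT : all straight move_cell) at_3.
  have le_6k : 6 <= k + 7 by lia.
  have [e3 e4 eo ei] := @move_cell_ok m (k + 7) h4 le_6k.
  set m' := foldl effect m move_cell in e3 e4 eo ei * => r.
  have [|||||m'' [r' e0 e1 e2 eall]] := IH m' e4; rewrite ?ei //.
  - move=> i /andP[le_6i lt_i]; rewrite ei; first by apply: hi; lia.
    by rewrite !inE /cell; lia.
  - move=> i /andP[]; rewrite leq_eqVlt => /predU1P[<- _|lt_ki lt_i].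
      by rewrite eo; apply: hi; lia.
    by rewrite ei; [apply: ho; lia|rewrite !inE /cell; lia].
  exists m''; split=> //.
  rewrite (_ : 14 * k.+2 = 12 + (14 * k.+1).+2); last by lia.
  apply: reaches_trans r _.
  apply: reaches_step; first by rewrite /= (at_4 0 isT) /= e3.
  have -> : (k + 7 - 6 == 0) = false by lia.
  by apply: reaches_step; first by rewrite /= (at_4 1 isT).
have le_top : 7 <= top by rewrite /top; nia.
have h4 : m2 4 = top - 7 + 7 by rewrite m24 m14 subnK // /top; lia.
have hi i : 6 <= i < top - 7 + 7 -> m2 i = inp i by case/andP=> /m2i.
have ho i : top - 7 + 7 <= i < top -> m2 (cell 0 i) = inp i by rewrite subnK //; lia.
have [m3 [r3 m30 m31 m32 m3i]] := move_all (top - 7) m2 h4 m20 m21 m22 hi ho.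
exists m3; split=> //.
have := reaches_trans r1 (reaches_trans r2 r3); apply: reaches_weaken.
by rewrite /top; nia.
Qed.

(* Register 0 points to the next entry of the output array, register 1 to its
   destination; the destination never overtakes the source. *)
Definition copy_init : program :=
  [:: IConst 0 (cell aOut 6); IConst 1 6; IConst 2 0; IAdd 2 2 rCount].

Definition copy_cell : program :=
  [:: ILoad 3 0; IStore 1 3; IConst 3 1; IAdd 1 1 3; ISub 2 2 3;
      IConst 3 16; IAdd 0 0 3].

Definition load_reg r : program := [:: IConst r (16 * r); IAdd r r 0; ILoad r r].

(** Cells 1 to 5 fetch their duplicates through the pointer in cell 0, so cell 0 is overwritten
    last. *)
Definition load_low : program :=
  flatten (map load_reg (iota 1 5)) ++ [:: ILoad 0 0].

Definition epilogue b : program :=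
  copy_init ++ IJz 2 (b + 13) :: copy_cell ++ IJmp (b + 4) :: load_low ++ [:: IHalt].

Lemma low_lt i : 6 <= i -> (i == 0 = false) * (i == 1 = false) * (i == 2 = false) *
  (i == 3 = false) * (i == 4 = false) * (i == 5 = false) *
  ((0 == i = false) * (1 == i = false) * (2 == i = false) *
  (3 == i = false) * (4 == i = false) * (5 == i = false)).
Proof. by move=> le_6i; do !split; lia. Qed.

Lemma copy_cell_ok (m : memory) y k : m 0 = cell aOut y -> m 1 = y -> m 2 = k.+1 ->
  6 <= y -> let m' := foldl effect m copy_cell in
  [/\ m' 0 = cell aOut y.+1, m' 1 = y.+1, m' 2 = k, m' y = m (cell aOut y) &
      forall i, 6 <= i -> i != y -> m' i = m i].
Proof.
move=> m0 m1 m2 le_6y; rewrite /= m0 /upd /= m1 m2 !(low_lt le_6y) /=.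
rewrite eqxx; split=> //; rewrite ?addn1 ?subn1 //; first by rewrite m0 /cell; lia.
by move=> i le_6i /negbTE ne_iy; rewrite !(low_lt le_6i) ne_iy.
Qed.

Lemma load_regs_ok (m : memory) rs : all (fun r => 0 < r < 6) rs -> 6 <= m 0 ->
  forall i, foldl effect m (flatten (map load_reg rs)) i =
            if i \in rs then m (16 * i + m 0) else m i.
Proof.
elim: rs m => [|r rs IH] m //= /andP[/andP[r_gt0 lt_r6] low] le_6m i.
set m1 := upd _ _ _.
have r0 : 0 == r = false by lia.
have m1E j : m1 j = if j == r then m (16 * r + m 0) else m j.
  rewrite /m1 /upd eqxx r0; case: eqP => // _.
  by have -> : 16 * r + m 0 == r = false by lia.
have m10 : m1 0 = m 0 by rewrite m1E r0.
rewrite IH // ?m10 // inE !m1E; have -> : 16 * i + m 0 == r = false by lia.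
by case: eqP => [->|] //=; case: (r \in rs).
Qed.

Lemma load_low_ok (m : memory) z : m 0 = cell aOut z ->
  let m' := foldl effect m load_low in
  (forall i, i < 6 -> m' i = m (cell aOut (z + i))) /\
  (forall i, 6 <= i -> m' i = m i).
Proof.
move=> m0; have le_6m : 6 <= m 0 by rewrite m0 /cell; lia.
have regs := load_regs_ok (isT : all (fun r => 0 < r < 6) (iota 1 5)) le_6m.
rewrite /load_low foldl_cat; set m1 := foldl effect m _ in regs *.
have m1E i : m1 i = if i \in iota 1 5 then m (16 * i + m 0) else m i by exact: regs.
move: m1E {regs}; clearbody m1 => m1E; rewrite [foldl _ _ _]/=.
have eq0 i : cell aOut (z + i) = 16 * i + m 0 by rewrite m0 /cell; lia.
split=> i hi; last by rewrite upd_neq ?m1E ?mem_iota; [case: ifP => //; lia|lia].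
rewrite eq0 /upd; case: eqP => [->|/eqP i_neq0].
  have m10 : m1 0 = m 0 by rewrite m1E.
  by rewrite m10 m1E mem_iota muln0 add0n; case: ifP => //; lia.
by rewrite m1E mem_iota; case: ifP => //; lia.
Qed.

Lemma epilogue_ok P b n m s : code_at P b (epilogue b) -> simulates n m s ->
  let N := reg s rCount in let o := arr s aOut in
  exists pc m', [/\ reaches P (9 * N + 21) (b, m) (pc, m'), nth IHalt P pc = IHalt,
    forall i, i < 6 -> m' i = o (6 + N + i) &
    forall i, 6 <= i < 6 + N -> m' i = o i].
Proof.
move=> at_e sim_m N o; have [_ hr ha] := sim_m.
case/code_at_cat: at_e => at_1; rewrite [size _]/= => /code_at_cons[at_z].
move=> /code_at_cat[at_2]; rewrite [size _]/= => /code_at_cons[at_j].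
move=> /code_at_cat[at_3]; rewrite [size _]/= => /code_at_cons[at_h _].
have := reaches_straight m (isT : all straight copy_init) at_1.
set m1 := foldl effect m copy_init; rewrite [size _]/= => r1.
have eo i : 6 <= i -> m1 (cell aOut i) = o i.
  move=> le_6i; have le_6c : 6 <= cell aOut i by rewrite /cell; lia.
  by rewrite /o -ha // /m1 /= /upd !(low_lt le_6c).
have [e0 e1 e2] : [/\ m1 0 = cell aOut 6, m1 1 = 6 & m1 2 = N].
  by rewrite /m1 /= /upd /= add0n hr.
have loop : forall k j (m : memory), m 2 = k -> j + k = N -> m 0 = cell aOut (6 + j) ->
    m 1 = 6 + j -> (forall i, 6 <= i < 6 + j -> m i = o i) ->
    (forall i, 6 + j <= i -> m (cell aOut i) = o i) ->
    exists m', [/\ reaches P (9 * k + 1) (b + 4, m) (b + 13, m'),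
      m' 0 = cell aOut (6 + N), forall i, 6 <= i < 6 + N -> m' i = o i &
      forall i, 6 + N <= i -> m' (cell aOut i) = o i].
  move=> k; elim: k => [|k IH] j m2 h2 hj h0 h1 hi ho.
    rewrite -hj addn0; exists m2; split=> //.
    apply: reaches_step; last exact: reaches_refl.
    by rewrite /ram_step at_z h2.
  have [f0 f1 f2 fy fi] := copy_cell_ok h0 h1 h2 (leq_addr _ _).
  have := reaches_straight m2 (isT : all straight copy_cell) at_2.
  set m3 := foldl effect m2 copy_cell in f0 f1 f2 fy fi *; rewrite [size _]/= => r3.
  have hj' : j.+1 + k = N by rewrite addSnnS.
  have [||m' [r' e0' ei' eo']] := IH j.+1 m3 f2 hj' f0 f1.
  - move=> i /andP[le_6i]; rewrite addnS ltnS leq_eqVlt => /predU1P[->|lt_i].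
      by rewrite fy ho.
    by rewrite fi ?hi ?le_6i // ltn_eqF.
  - by move=> i lt_i; rewrite fi ?ho //; rewrite /cell; lia.
  exists m'; split=> //.
  apply: (@reaches_weaken _ (7 + (9 * k + 1).+1).+1); first by lia.
  apply: reaches_step; first by rewrite /ram_step at_z h2.
  apply: reaches_trans r3 _.
  by apply: reaches_step; first by rewrite /ram_step at_j.
have [||m2 [r2 h0 hi ho]] := loop N 0 m1 e2 (add0n _) e0 e1.
- by move=> i; lia.
- by move=> i; rewrite addn0; exact: eo.
have [lo hi'] := load_low_ok h0.
have := reaches_straight m2 (isT : all straight load_low) at_3.
set m3 := foldl effect m2 load_low in lo hi' *; rewrite [size _]/= => r3.
exists (((b + 4).+1 + 7).+1 + 16), m3; split=> //.
- have e13 : b + 13 = ((b + 4).+1 + 7).+1 by lia.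
  rewrite -e13 in r3 *.
  by have := reaches_trans r1 (reaches_trans r2 r3); apply: reaches_weaken; lia.
- by move=> i lt_i; rewrite lo // ho //; lia.
by move=> i /andP[le_6i lt_i]; rewrite hi' // hi // le_6i.
Qed.

Lemma copy_low_ok n s k : k <= reg s rEnd -> let s' := ev n (copy_low k) s in
  [/\ reg s' rCount = reg s rCount, reg s' rEnd = reg s rEnd,
      forall i, i < reg s rEnd -> arr s' aOut i = arr s aOut i &
      forall i, i < k -> arr s' aOut (reg s rEnd + i) = arr s aOut i].
Proof.
elim: k => [|k IH] le_k //=; have [c e lo hi] := IH (ltnW le_k).
rewrite evE; set s1 := ev n (copy_low k) s in c e lo hi *; rewrite evE /= e.
split=> // i lt_i; first by rewrite upd_neq ?lo //; lia.
move: lt_i; rewrite ltnS leq_eqVlt => /predU1P[->|lt_i].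
  by rewrite upd_eq lo //; exact: leq_trans le_k.
by rewrite upd_neq ?hi //; lia.
Qed.

(** When no sequence exists [rLen] was never set; resetting it keeps the copy loop short. N is the
    number of output entries beyond the first six. *)
Lemma emit_ok n s : let s' := ev n emit s in
  let len := if reg s rOk == 0 then 0 else reg s rLen in
  let N := 2 + len + len - 6 in
  [/\ reg s' rCount = N, arr s' aOut (6 + N) = reg s rOk,
      arr s' aOut (6 + N + 1) = len &
      forall i, 2 <= i -> (i < 6 + N -> arr s' aOut i = arr s aOut i) /\
        (i < 6 -> arr s' aOut (6 + N + i) = arr s aOut i)].
Proof.
rewrite /emit (ev_seq _ (If _ _ _)); set s1 := ev n (If _ _ _) s.
have [ok1 out1 len1] : [/\ reg s1 rOk = reg s rOk, arr s1 aOut = arr s aOut &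
    reg s1 rLen = if reg s rOk == 0 then 0 else reg s rLen].
  by rewrite /s1 !evE /=; case: eqP => // ->.
cbv zeta; rewrite -len1 -ok1 -out1 !(ev_seq _ (Put _ _ _)) !(ev_seq _ (_ ::= _)).
set len := reg s1 rLen; set N := 2 + len + len - 6.
set s2 := ev n (rEnd ::= _) _.
have [c2 e2 o2] : [/\ reg s2 rCount = N, reg s2 rEnd = 6 + N &
    arr s2 aOut = upd (upd (arr s1 aOut) 0 (reg s1 rOk)) 1 len].
  by rewrite /s2 !evE.
have [|c3 e3 lo hi] := @copy_low_ok n s2 6; first by rewrite e2.
rewrite e2 o2 /= in lo hi; split; first by rewrite c3.
- by rewrite -[6 + N]addn0 hi // upd_neq // upd_eq.
- by rewrite hi // upd_eq.
move=> i le_2i; split=> lt_i.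
  by rewrite lo // !upd_neq //; lia.
by rewrite hi // !upd_neq //; lia.
Qed.

Lemma verdict_ok n s : reg (ev n verdict s) rAns =
  (reg s rOk != 0) && (reg s rLen <= reg s rL).
Proof.
rewrite /verdict !evE /=; case: eqP => //= _; rewrite -subn_eq0.
by case: eqP.
Qed.

(** * Token placements *)

Section Tokens.

Variables (n : nat) (G : rel 'I_n).

Hypotheses (symG : symmetric G) (irrG : irreflexive G).

Lemma nat_relE (u v : 'I_n) : nat_rel G u v = G u v.
Proof. by rewrite /nat_rel !valK. Qed.

Lemma nat_rel_sym : symmetric (nat_rel G).
Proof.
move=> u v; rewrite /nat_rel; case: (insub u) => [a|]; case: (insub v) => [b|] //; exact: symG.
Qed.

Lemma nat_rel_lt u v (lt_u : u < n) (lt_v : v < n) :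
  nat_rel G u v = G (Ordinal lt_u) (Ordinal lt_v).
Proof. exact: (nat_relE (Ordinal lt_u) (Ordinal lt_v)). Qed.

(** On a placement 2 - f v is the indicator of color 1. *)
Definition weight (w : 'I_n -> nat) (f : 'I_n -> nat) := \sum_(v < n) w v * (2 - f v).

(** A swap at most trades w u for w v in the total. *)
Lemma adjacent_weight w c f f' : (forall u v, G u v -> w v <= w u + c) ->
  token_placement 2 f -> tp_adjacent G f f' ->
  weight w f' <= weight w f + c /\ weight w f <= weight w f' + c.
Proof.
move=> lip [f_range _] [_ [u [v [Guv [fu [fv same]]]]]].
have ne_vu : v != u by apply: contraTneq Guv => ->; rewrite irrG.
have weightE h : weight w h = w u * (2 - h u) + (w v * (2 - h v) +
    \sum_(i < n | (i != u) && (i != v)) w i * (2 - h i)).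
  by rewrite /weight (bigD1 u) //= (bigD1 v).
rewrite !weightE fu fv.
have -> : \sum_(i < n | (i != u) && (i != v)) w i * (2 - f' i) =
          \sum_(i < n | (i != u) && (i != v)) w i * (2 - f i).
  by apply: eq_bigr => i /andP[/eqP iu /eqP iv]; rewrite same.
have [huv hvu] : w v <= w u + c /\ w u <= w v + c by rewrite !lip // symG.
have [] := (f_range u, f_range v); set rest := \sum_(i < n | _) _.
have : f u = 1 \/ f u = 2 by have := f_range u; lia.
have : f v = 1 \/ f v = 2 by have := f_range v; lia.
by case=> ->; case=> -> _ _; lia.
Qed.

Lemma swapping_weight w c f s ft : (forall u v, G u v -> w v <= w u + c) ->
  token_placement 2 f -> swapping_seq 2 G f s ft ->
  weight w ft <= weight w f + c * size s /\ weight w f <= weight w ft + c * size s.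
Proof.
move=> lip; elim: s f => [|g s IH] f tf /=.
  move=> eq_f; suff -> : weight w f = weight w ft by rewrite muln0 addn0.
  by apply: eq_bigr => v _; rewrite eq_f.
move=> [tg [adj /(IH g tg)]]; have := adjacent_weight lip tf adj.
by rewrite mulnS; lia.
Qed.

(** Intermediate maps stay surjective because the two swapped vertices carry different colors. *)
Lemma realize pi (c d : nat -> nat) L f ft : token_placement 2 f ->
  (forall v : 'I_n, f v = 2 - c v) -> (forall v : 'I_n, ft v = 2 - d v) ->
  moves n (nat_rel G) pi c L d ->
  exists s, [/\ swapping_seq 2 G f s ft, size s = size L &
    forall x0 j, j < size s -> exists u v : 'I_n,
      [/\ val u = (nth (0, 0) L j).1, val v = (nth (0, 0) L j).2 &
          forall w, nth x0 s j w = swap_at (nth x0 (f :: s) j) u v w]].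
Proof.
move=> tf fE ftE; elim: L c f tf fE => [|[a b] L IH] c f tf fE /=.
  by move=> cd; exists [::]; split=> // v; rewrite fE ftE cd.
case=> -[[lt_a lt_b Gab] _ ca cb] mv.
set u := Ordinal lt_a; set v := Ordinal lt_b.
have fu : f u = 1 by rewrite fE ca.
have fv : f v = 2 by rewrite fE cb.
have ne_uv : u != v by apply/eqP => e; move: fu; rewrite e fv.
set g := swap_at f u v.
have gE w : g w = 2 - moved c a b w.
  rewrite /g /swap_at /moved fu fv -!val_eqE /=.
  case: (val w =P a) => [->|_]; last by case: eqP; rewrite ?fE.
  by rewrite -[a]/(val u) -[b]/(val v) val_eqE (negbTE ne_uv).
have tg : token_placement 2 g.
  split=> [w|k hk].
    rewrite /g /swap_at fu fv; case: ifP => // _; case: ifP => // _.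
    exact: tf.1.
  have [->|->] : k = 1 \/ k = 2 by lia.
    by exists v; rewrite /g /swap_at eq_sym (negbTE ne_uv) eqxx.
  by exists u; rewrite /g /swap_at eqxx.
have [s [sw sz enc]] := IH _ g tg gE mv.
exists (g :: s); split=> /=; [|by rewrite sz|].
  split=> //; split=> //; split.
    by exists u; rewrite /g /swap_at eqxx fu fv.
  exists u, v; rewrite -nat_rel_lt Gab /g /swap_at !eqxx eq_sym (negbTE ne_uv).
  by split=> //; split=> //; split=> // w /eqP/negbTE-> /eqP/negbTE->.
by move=> x0 [|j] lt_j /=; [exists u, v|exact: enc].
Qed.

End Tokens.

(** Each legal move climbs exactly one level, so the end configurations determine the length and the
    bound of [swapping_weight] for c = 1 is attained. *)
Lemma moves_potential n G pi f L g : moves n G pi f L g ->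
  \sum_(v < n) pi v * g v = \sum_(v < n) pi v * f v + size L.
Proof.
elim: L f => [|[a b] L IH] f /=.
  by move=> fg; rewrite addn0; apply: eq_bigr => v _; rewrite fg.
case=> -[[lt_a lt_b _] pib fa fb] /IH ->; rewrite addnS -addSn; congr (_ + _).
have sum1 k : k < n -> \sum_(v < n) pi v * (v == k :> nat) = pi k.
  move=> lt_k; rewrite (bigD1 (Ordinal lt_k)) //= eqxx muln1 big1 ?addn0 // => v.
  by rewrite -val_eqE /= => /negbTE->; rewrite muln0.
have : \sum_(v < n) pi v * moved f a b v + pi a = \sum_(v < n) pi v * f v + pi b.
  rewrite -(sum1 a lt_a) -(sum1 b lt_b) -!big_split; apply: eq_bigr => v _ /=.
  rewrite -!mulnDr /moved; congr (_ * _).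
  case: (val v =P b) => [->|_]; last by case: (val v =P a) => [->|_]; rewrite ?fa.
  by rewrite fb; case: eqP => // e; move: fa; rewrite -e fb.
by rewrite pib addnS => /eqP; rewrite -addSn eqn_add2r => /eqP.
Qed.

(** * Correctness on encoded instances *)

Section Instance.

Variables (n : nat) (G : rel 'I_n) (f0 ft : 'I_n -> nat) (l : nat).

Hypotheses (symG : symmetric G) (irrG : irreflexive G).
Hypotheses (tp0 : token_placement 2 f0) (tpt : token_placement 2 ft).

Let inp := input_mem G f0 ft l.

(** Both colors occur. With two vertices, cells 2 to 5 are adjacency entries, as the prologue
    assumes. *)
Lemma placement_size : 1 < n.
Proof.
have [[u fu] [v fv]] := (tp0.2 1 isT, tp0.2 2 isT).
have : val u != val v by apply: contra_eq_neq fu => /val_inj ->; rewrite fv.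
by have := ltn_ord u; have := ltn_ord v; rewrite /=; lia.
Qed.

Let n_gt1 := placement_size.

Lemma input_adj u v : u < n -> v < n -> inp (2 + u * n + v) = nat_rel G u v.
Proof.
move=> lt_u lt_v; rewrite /inp /input_mem -addnA.
have -> : 2 + (u * n + v) < 2 + n * n by rewrite ltn_add2l; nia.
have n_gt0 : 0 < n by exact: ltnW.
by rewrite addKn divnMDl // divn_small // addn0 modnMDl modn_small.
Qed.

Lemma input_src (v : 'I_n) : inp (2 + n * n + v) = f0 v.
Proof.
have lt_v := ltn_ord v; rewrite /inp /input_mem.
have -> : (2 + n * n + v < 2 + n * n) = false by lia.
have -> : 2 + n * n + v < 2 + n * n + n by lia.
have -> : 2 + n * n + v - 2 - n * n = v by lia.
by rewrite /= /nat_fun valK.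
Qed.

Lemma input_dst (v : 'I_n) : inp (2 + n * n + n + v) = ft v.
Proof.
rewrite /inp /input_mem.
have -> : (2 + n * n + n + v < 2 + n * n) = false by lia.
have -> : (2 + n * n + n + v < 2 + n * n + n) = false by lia.
rewrite ltn_add2l ltn_ord /=.
have -> : 2 + n * n + n + v - 2 - n * n - n = v by lia.
by rewrite /= /nat_fun valK.
Qed.

Lemma input_diag : inp 2 = 0.
Proof.
have n_gt0 : 0 < n by exact: ltnW.
by rewrite -[2]/(2 + 0 * n + 0) input_adj // (nat_rel_lt G n_gt0 n_gt0) irrG.
Qed.

Lemma input_bit i : i < 4 -> inp (2 + i) <= 1.
Proof.
move=> lt_i4; rewrite /inp /input_mem /= ltn_add2l.
have -> : i < n * n by nia.
by case: nat_rel.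
Qed.

Let src v := 2 - inp (2 + n * n + v).
Let dst v := 2 - inp (2 + n * n + n + v).

Lemma srcE (v : 'I_n) : src v = 2 - f0 v. Proof. by rewrite /src input_src. Qed.
Lemma dstE (v : 'I_n) : dst v = 2 - ft v. Proof. by rewrite /dst input_dst. Qed.

Lemma src_le1 v : v < n -> src v <= 1.
Proof.
by move=> lt_v; rewrite (srcE (Ordinal lt_v)); have := tp0.1 (Ordinal lt_v); lia.
Qed.

Lemma dst_le1 v : v < n -> dst v <= 1.
Proof.
by move=> lt_v; rewrite (dstE (Ordinal lt_v)); have := tpt.1 (Ordinal lt_v); lia.
Qed.

(** The bound on the length of L serves the running time: copying the output then takes O(n^2)
    steps. *)
Definition solved s :=
  (reg s rOk = 0 /\ forall sw, ~ swapping_seq 2 G f0 sw ft) \/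
  (reg s rOk = 1 /\ exists L sw, [/\ logged s L, min_swapping_seq 2 G f0 ft sw,
     size sw = size L, size L <= 2 * n ^ 2 &
     forall j, j < size sw -> exists u v : 'I_n,
      [/\ val u = (nth (0, 0) L j).1, val v = (nth (0, 0) L j).2 &
          forall w, nth f0 sw j w = swap_at (nth f0 (f0 :: sw) j) u v w]]).

Lemma solve_correct s : loaded n inp s -> solved (ev n solve s).
Proof.
move=> ld; have b3 : inp 3 <= 1 by exact: (@input_bit 1).
have b4 : inp 4 <= 1 by exact: (@input_bit 2).
have b5 : inp 5 <= 1 by exact: (@input_bit 3).
have [[ok [w inv_w ne]]|[ok [pi [L [lip pi_le mv lg]]]]] :=
  solve_ok n_gt1 (nat_rel_sym symG) input_adj input_diag src_le1 dst_le1 b3 b4 b5 ld.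
  (* Slack 0: no swap changes this weight, yet it differs between [f0] and [ft]. *)
  left; split=> // sw seq_sw; move: ne; apply/negP; rewrite negbK; apply/eqP.
  have lip0 (u v : 'I_n) : G u v -> w v <= w u + 0.
    by move=> Guv; rewrite addn0 (inv_w u v) // nat_relE.
  have [] := swapping_weight symG irrG (w := fun v => w v) lip0 tp0 seq_sw.
  rewrite /weight mul0n !addn0 => le1 le2.
  under eq_bigr do rewrite input_src; under [RHS]eq_bigr do rewrite input_dst.
  by apply/eqP; rewrite eqn_leq le2.
right; split=> //.
have f0E v : f0 v = 2 - src v by rewrite srcE; have := tp0.1 v; lia.
have ftE v : ft v = 2 - dst v by rewrite dstE; have := tpt.1 v; lia.
have [sw [seq_sw size_sw enc]] := realize tp0 f0E ftE mv.
have pot := moves_potential mv.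
exists L, sw; split=> //; first split=> // sw' seq_sw'.
- have lip1 (u v : 'I_n) : G u v -> pi v <= pi u + 1.
    by move=> Guv; rewrite addn1 lip // nat_relE.
  have [] := swapping_weight symG irrG (w := fun v => pi v) lip1 tp0 seq_sw'.
  rewrite /weight mul1n size_sw; move: pot.
  under eq_bigr do rewrite input_dst; under [in RHS]eq_bigr do rewrite input_src.
  by move=> ->; rewrite leq_add2l.
(* At most n tokens, each at potential at most 2n. *)
- have : \sum_(v < n) pi v * dst v <= \sum_(v < n) (n + n).
    by apply: leq_sum => v _; have := pi_le v (ltn_ord v); have := dst_le1 (ltn_ord v); nia.
  by rewrite pot sum_nat_const card_ord; lia.
by move=> j lt_j; exact: enc.
Qed.

End Instance.

(** * Assembly of the two programs *)

Lemma run_solve c tail : wf_cmd c -> nesting c <= 3 ->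
  let P := prologue ++ compile c 28 ++ tail in
  exists C, forall n (inp : memory), 1 < n -> inp 0 = n ->
  exists m s, [/\ reaches P (C * n ^ 3) (0, inp) (28 + clen c, m),
    simulates n m (ev n c s), reg s rL = inp 1 & loaded n inp s].
Proof.
move=> wf_c nest P; have [C costE] := cost_polynomial c.
(* 108 = 18 + 40 + 50 covers the prologue, and 8 comes from (n + 1)^3 <= (2n)^3. *)
exists (108 + C * 8) => n inp n_gt1 inp0.
have at_p : code_at P 0 prologue by exact: (@code_at_mid [::]).
have at_c : code_at P 28 (compile c 28) by exact: (@code_at_mid prologue).
have [m [r m0 m1 ld]] := prologue_ok at_p n_gt1 inp0.
have [m' r' sim'] := compile_ok wf_c (simulates_state_of m0) at_c.
exists m', (state_of m); split=> //.
apply: reaches_weaken (reaches_trans r r'); rewrite mulnDl; apply: leq_add.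
  by rewrite !expnS expn0; nia.
apply: leq_trans (costE n) _; rewrite -mulnA leq_mul2l; apply/orP; right.
apply: (@leq_trans (n.+1 ^ 3)); first by rewrite leq_pexp2l.
by rewrite -[8]/(2 ^ 3) -expnMn leq_exp2r //; lia.
Qed.

Theorem mainTheorem7 :
  (* decision version: O(n^3) time *)
  (exists (P : program) (C : nat),
    forall (n : nat) (G : rel 'I_n) (f0 ft : 'I_n -> nat) (l : nat),
      symmetric G -> irreflexive G ->
      token_placement 2 f0 -> token_placement 2 ft ->
      exists m, ram_exec P (C * n ^ 3 + C) (0, input_mem G f0 ft l) = Some m /\
        m 0 <= 1 /\ (m 0 = 1 <-> OPT_le 2 G f0 ft l))
  /\
  (* construction of a minimum-length swapping sequence: O(n^3) time *)
  (exists (P : program) (C : nat),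
    forall (n : nat) (G : rel 'I_n) (f0 ft : 'I_n -> nat),
      symmetric G -> irreflexive G ->
      token_placement 2 f0 -> token_placement 2 ft ->
      exists m, ram_exec P (C * n ^ 3 + C) (0, input_mem G f0 ft 0) = Some m /\
        ((m 0 = 0 /\ forall s, ~ swapping_seq 2 G f0 s ft) \/
         (exists s, min_swapping_seq 2 G f0 ft s /\ encodes_seq f0 s m))).
Proof.
split.
  set c := solve ;; verdict; set tail := [:: IConst 0 0; IAdd 0 0 rAns; IHalt].
  have [|//|C run] := @run_solve c tail; first by vm_compute.
  set P := prologue ++ compile c 28 ++ tail in run.
  exists P, (C + 2) => n G f0 ft l symG irrG tp0 tpt.
  have n_gt1 := placement_size tp0.
  have [m [s [r sim_m rl ld]]] := run n (input_mem G f0 ft l) n_gt1 erefl.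
  have at_t : code_at P (28 + clen c) tail.
    have -> : 28 + clen c = size (prologue ++ compile c 28).
      by rewrite size_cat size_compile.
    by rewrite /P catA; exact: code_at_end.
  set pc := 28 + clen c in r at_t.
  set m' := foldl effect m [:: IConst 0 0; IAdd 0 0 rAns].
  have at_t2 : code_at P pc [:: IConst 0 0; IAdd 0 0 rAns].
    exact: (@code_at_cat P pc [:: _; _] [:: IHalt] at_t).1.
  have r2 : reaches P 2 (pc, m) (pc + 2, m') :=
    @reaches_straight P pc [:: IConst 0 0; IAdd 0 0 rAns] m isT at_t2.
  have m'0 : m' 0 = (reg (ev n solve s) rOk != 0) && (reg (ev n solve s) rLen <= l).
    have [_ hr _] := sim_m; rewrite /m' /= /upd /= hr // /c ev_seq verdict_ok.
    by rewrite ((frame_ev n solve s).1 1 isT) rl.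
  exists m'; split.
    apply: reaches_halt (at_t 2 isT); apply: reaches_weaken (reaches_trans r r2).
    by rewrite mulnDl; have : 0 < n ^ 3 by [rewrite expn_gt0; lia]; lia.
  split; first by rewrite m'0 leq_b1.
  have [[ok no]|[ok [L [sw [[lenE _] [seq_sw min_sw] size_sw _ _]]]]] :=
      solve_correct symG irrG tp0 tpt ld; rewrite m'0 ok /=.
    by split=> // -[sw [/no]].
  rewrite lenE -size_sw; split=> [le_l|[sw' [/min_sw le_sw le_l]]].
    by exists sw; split=> //; case: leqP le_l.
  by rewrite (leq_trans le_sw).
set c := solve ;; emit; set b := 28 + clen c.
have [|//|C run] := @run_solve c (epilogue b); first by vm_compute.
set P := prologue ++ compile c 28 ++ epilogue b in run.
(* The epilogue takes at most 9 N + 21 steps, where N <= 2 * size L <= 4 n^2. *)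
exists P, (C + 60) => n G f0 ft symG irrG tp0 tpt.
have n_gt1 := placement_size tp0.
have [m [s [r sim_m _ ld]]] := run n (input_mem G f0 ft 0) n_gt1 erefl.
have at_e : code_at P b (epilogue b).
  rewrite /P catA [X in code_at _ X](_ : _ = size (prologue ++ compile c 28)).
    exact: code_at_end.
  by rewrite size_cat size_compile.
have [pc [m' [r2 halt lo hi]]] := epilogue_ok at_e sim_m.
rewrite /c ev_seq in lo hi r2.
have [cnt o_ok o_len o_rest] := emit_ok n (ev n solve s).
rewrite cnt in lo hi r2.
have [[ok no]|[ok [L [sw [[lenE logE] min_sw size_sw size_le enc]]]]] :=
    solve_correct symG irrG tp0 tpt ld; rewrite ok /= in lo hi r2 o_ok o_len o_rest *.
  exists m'; split; last by left; split=> //; rewrite lo // addn0 o_ok.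
  apply: reaches_halt halt; apply: reaches_weaken (reaches_trans r r2).
  by rewrite mulnDl; have : 0 < n ^ 3 by [rewrite expn_gt0; lia]; lia.
rewrite lenE in lo hi r2 o_ok o_len o_rest.
exists m'; split.
  apply: reaches_halt halt; apply: reaches_weaken (reaches_trans r r2).
  have : n ^ 2 <= n ^ 3 by rewrite leq_pexp2l //; lia.
  by rewrite mulnDl; lia.
right; exists sw; split=> //; split; first by rewrite lo // addn0 o_ok.
split; first by rewrite lo // o_len size_sw.
(* Entries below 6 are read back from the duplicates, the others from the copied block. *)
have outE i : 2 <= i -> i < 2 + size L + size L -> m' i = arr (ev n solve s) aOut i.
  move=> le_2i lt_i; have [keep dup] := o_rest i le_2i.
  case: (ltnP i 6) => [lt_i6|le_6i]; first by rewrite lo // dup.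
  by rewrite hi ?keep ?le_6i //=; lia.
move=> j lt_j; have [u [v [uE vE stepE]]] := enc j lt_j.
have lt_jL : j < size L by rewrite -size_sw.
have [logu logv] := logE j lt_jL.
exists u, v; split; first by rewrite outE ?logu //; lia.
by split; first by rewrite outE ?logv //; lia.
Qed.
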